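(* Let $(X_0,X_1)$ be a compatible couple and let $a\in SV(0,\infty)\cap AC(0,\infty)$ satisfy $$a\ \text{is strictly decreasing},\quad a(0)=\infty,\quad a(\infty)>0.$$ Let $\alpha\in SV(0,\infty)\cap AC(0,\infty)$ be such that $$\alpha\ \text{is strictly decreasing},\quad \alpha(0)=\infty,\quad \alpha(\infty)=0,$$ and assume that $A\in SV(0,\infty)$ is given by $$A(x):=a(x)\ \text{ if } x\in(0,1],\qquad A(x):=c\,\alpha(x)\ \text{ if } x\in(1,\infty),$$ where $c$ is a positive constant chosen in such a way that $A\in AC(0,\infty)$. If $$B(x):=-x\,A'(x)\quad\text{for a.a. } x>0,$$ then $$(X_0,X_1)_{0,1,a;J}=(X_0,X_0\cap X_1)_{0,1,A;J}=(X_0,X_0\cap X_1)_{0,1,B;K}.$$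
   Context: A pair $(X_0,X_1)$ of Banach spaces is a compatible couple if there is a Hausdorff topological vector space in which both $X_0$ and $X_1$ are continuously embedded. $X_0\cap X_1$ carries the norm $\max\{\|f\|_{X_0},\|f\|_{X_1}\}$ and $X_0+X_1$ the norm $\inf\{\|f_0\|_{X_0}+\|f_1\|_{X_1}: f=f_0+f_1\}$. For $t>0$, $$K(f,t;X_0,X_1):=\inf\{\|f_0\|_{X_0}+t\|f_1\|_{X_1}: f=f_0+f_1,\ f_0\in X_0,\ f_1\in X_1\}\quad (f\in X_0+X_1),$$ $$J(f,t;X_0,X_1):=\max\{\|f\|_{X_0},t\|f\|_{X_1}\}\quad (f\in X_0\cap X_1).$$ $\|\cdot\|_{1,(c,d)}$ is the $L_1$-norm on $(c,d)$. For a weight $v$ on $(0,\infty)$ (non-negative, measurable, finite a.e.): - $(X_0,X_1)_{0,1,v;K}$ is the set of $f\in X_0+X_1$ with $\|f\|_{0,1,v;K}:=\|t^{-1}v(t)K(f,t;X_0,X_1)\|_{1,(0,\infty)}<\infty$. - $(X_0,X_1)_{0,1,v;J}$ is the set of $f\in X_0+X_1$ for which there is a strongly measurable $u:(0,\infty)\to X_0\cap X_1$ with $f=\int_0^\infty u(s)\,\frac{ds}{s}$ (convergence in $X_0+X_1$) and for which $\|f\|_{0,1,v;J}:=\inf\|t^{-1}v(t)J(u(t),t;X_0,X_1)\|_{1,(0,\infty)}$ is finite, the infimum being over all such representations of $f$. The same definitions are used for the compatible couple $(X_0,X_0\cap X_1)$. Equality of two spaces means that they are equal as sets and their norms are equivalent.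 $SV(0,\infty)$ is the set of slowly varying functions: positive, finite, Lebesgue-measurable functions $b$ on $(0,\infty)$ such that for each $\varepsilon>0$, $t^{\varepsilon}b(t)$ is equivalent to a non-decreasing function on $(0,\infty)$ and $t^{-\varepsilon}b(t)$ is equivalent to a non-increasing function on $(0,\infty)$ (two non-negative functions are equivalent if each is bounded by a positive constant multiple of the other). $AC(0,\infty)$ is the set of functions that are absolutely continuous on every compact subinterval of $(0,\infty)$. For monotone $f$ on $(0,\infty)$, $f(0):=\lim_{t\to0+}f(t)$ and $f(\infty):=\lim_{t\to\infty}f(t)$. *)

(* Defs.v *)
From HB Require Import structures.
From mathcomp Require Import all_boot all_order all_algebra.
From mathcomp Require Import all_classical all_reals all_analysis.
From mathcomp Require Import measurable_realfun.

Set Implicit Arguments.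
Unset Strict Implicit.
Unset Printing Implicit Defensive.

Import Order.TTheory GRing.Theory Num.Theory.
Import numFieldNormedType.Exports.

Local Open Scope classical_set_scope.
Local Open Scope ring_scope.

Section bochner.
Context d (T : measurableType d) (R : realType) (E : normedModType R).
Variables (mu : {measure set T -> \bar R}) (D : set T).

Definition simple_on (s : T -> E) : Prop :=
  finite_set (s @` D) /\ forall y, measurable (D `&` s @^-1` [set y]).

(* For Lebesgue measure the library's measurable sets are the Borel sets; as the
   convergence is only required almost everywhere, Lebesgue-measurable simple
   functions would give the same notion. *)
Definition strongly_measurable (u : T -> E) : Prop :=
  exists s : nat -> T -> E,
    (forall n, simple_on (s n)) /\
    {ae mu, forall x, D x -> s n x @[n --> \oo] --> u x}.

(* For an integrable simple function, the level set of 0 may have infinite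
   measure; its term is then fine +oo *: 0 = 0. *)
Definition simple_integral (s : T -> E) : E :=
  \sum_(y \in s @` D) fine (mu (D `&` s @^-1` [set y])) *: y.

Definition is_bochner_integral (u : T -> E) (z : E) : Prop :=
  exists s : nat -> T -> E,
    [/\ forall n, simple_on (s n),
        forall n y, y != 0 -> (mu (D `&` s n @^-1` [set y]) < +oo)%E,
        {ae mu, forall x, D x -> s n x @[n --> \oo] --> u x},
        (\int[mu]_(x in D) (`|u x - s n x|%:E))%E @[n --> \oo] --> 0%E &
        simple_integral (s n) @[n --> \oo] --> z].

End bochner.

(* The ambient space is any topological vector space, not necessarily locally
   convex (tvsType would impose local convexity). *)
Record compatible_couple (R : realType) (V : topologicalLmodType R)
    (X0 X1 : completeNormedModType R) := CompatibleCouple {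
  emb0 : {linear X0 -> V};
  emb1 : {linear X1 -> V};
  emb0_inj : injective emb0;
  emb1_inj : injective emb1;
  emb0_continuous : continuous (emb0 : X0 -> V);
  emb1_continuous : continuous (emb1 : X1 -> V);
  ambient_hausdorff : hausdorff_space V
}.

Section intersection.
Context {R : realType} {V : topologicalLmodType R}.
Context {X0 X1 : completeNormedModType R} (C : compatible_couple V X0 X1).

Definition inter_pred : {pred X0 * X1} :=
  fun p => `[< emb0 C p.1 = emb1 C p.2 >].

Lemma inter_predP (p : X0 * X1) :
  reflect (emb0 C p.1 = emb1 C p.2) (p \in inter_pred).
Proof. exact: asboolP. Qed.

Fact inter_submod_closed : submod_closed inter_pred.
Proof.
split; first by apply/inter_predP; rewrite /= !linear0.
move=> k p q /inter_predP pP /inter_predP qP; apply/inter_predP => /=.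
by rewrite !linearP pP qP.
Qed.

HB.instance Definition _ :=
  GRing.isSubmodClosed.Build R (X0 * X1)%type inter_pred inter_submod_closed.

(* An element of the intersection is kept as the pair (x0, x1) of its copies in
   X0 and X1, which have the same image in the ambient space. *)
Record inter_space := InterSpace {
  inter_val : X0 * X1;
  inter_valP : inter_val \in inter_pred
}.

HB.instance Definition _ := [isSub for inter_val].
HB.instance Definition _ := [Choice of inter_space by <:].
HB.instance Definition _ := [SubChoice_isSubLmodule of inter_space by <:].

Definition inter_norm (x : inter_space) : R :=
  Num.max `|(inter_val x).1| `|(inter_val x).2|.

Fact inter_normD x y : inter_norm (x + y) <= inter_norm x + inter_norm y.
Proof. exact: (ler_normD (inter_val x) (inter_val y)). Qed.

Fact inter_normZ (k : R) x : inter_norm (k *: x) = `|k| * inter_norm x.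
Proof. exact: (normrZ k (inter_val x)). Qed.

Fact inter_norm0_eq0 x : inter_norm x = 0 -> x = 0.
Proof.
by move=> x0; apply/val_inj/eqP; rewrite -normr_eq0; apply/eqP.
Qed.

HB.instance Definition _ := Lmodule_isNormed.Build R inter_space
  inter_normD inter_normZ inter_norm0_eq0.

Fact inter_norm_val (x : inter_space) : `|x| = `|inter_val x|.
Proof. by []. Qed.

Fact inter_val_continuous : continuous inter_val.
Proof.
move=> x; apply/(@cvgrPdist_lt _ _ _ (nbhs x) (nbhs_filter x)) => e e0.
apply: filterS (nbhsx_ballx x e e0) => y.
by rewrite -ball_normE /= inter_norm_val.
Qed.

Fact inter_space_complete (F : set_system inter_space) :
  ProperFilter F -> cauchy F -> cvg F.
Proof.
move=> FF /cauchyP Fc.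
have F0 : cauchy ((inter_val x).1 @[x --> F]).
  apply/cauchyP => e e0; have [x Fx] := Fc e e0.
  exists (inter_val x).1; rewrite /nbhs /=; move: Fx; apply: filterS => y.
  rewrite -!ball_normE /= inter_norm_val.
  by apply: le_lt_trans; rewrite prod_normE le_max lexx.
have F1 : cauchy ((inter_val x).2 @[x --> F]).
  apply/cauchyP => e e0; have [x Fx] := Fc e e0.
  exists (inter_val x).2; rewrite /nbhs /=; move: Fx; apply: filterS => y.
  rewrite -!ball_normE /= inter_norm_val.
  by apply: le_lt_trans; rewrite prod_normE le_max lexx orbT.
have [l0 Fl0] := (cvg_ex _).1 (cauchy_cvg _ F0).
have [l1 Fl1] := (cvg_ex _).1 (cauchy_cvg _ F1).
have l01 : (l0, l1) \in inter_pred.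
  apply/inter_predP => /=.
  have cv0 : emb0 C (inter_val x).1 @[x --> F] --> emb0 C l0.
    exact: (cvg_comp _ _ Fl0 (@emb0_continuous _ _ _ _ C l0)).
  have cv1 : emb0 C (inter_val x).1 @[x --> F] --> emb1 C l1.
    rewrite (_ : (fun x => _) = fun x => emb1 C (inter_val x).2).
      exact: (cvg_comp _ _ Fl1 (@emb1_continuous _ _ _ _ C l1)).
    by apply/funext => x; exact/inter_predP/inter_valP.
  exact: (cvg_unique (ambient_hausdorff C) cv0 cv1).
apply/cvg_ex; exists (InterSpace l01); apply/cvg_ballP => e e0.
move/cvgrPdist_lt : Fl0 => /(_ e e0) Fl0.
move/cvgrPdist_lt : Fl1 => /(_ e e0) Fl1.
apply: filterS2 Fl0 Fl1 => x x0 x1.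
by rewrite -ball_normE /= inter_norm_val prod_normE gt_max x0.
Qed.

HB.instance Definition _ :=
  Uniform_isComplete.Build inter_space inter_space_complete.

Definition inter_emb (x : inter_space) : V := emb0 C (inter_val x).1.

Fact inter_emb_linear : linear inter_emb.
Proof. by move=> k x y; rewrite /inter_emb linearP. Qed.

HB.instance Definition _ :=
  GRing.isLinear.Build R inter_space V *:%R inter_emb inter_emb_linear.

Fact inter_emb_inj : injective inter_emb.
Proof.
move=> x y xy; apply: val_inj.
have x01 := elimT (inter_predP _) (inter_valP x).
have y01 := elimT (inter_predP _) (inter_valP y).
apply/pair_eqP/andP; split; apply/eqP; first exact: emb0_inj xy.
by apply: (emb1_inj (c := C)); rewrite -x01 -y01.
Qed.

Fact inter_emb_continuous : continuous inter_emb.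
Proof.
move=> x; apply: (@continuous_comp _ _ _ (fst \o inter_val) (emb0 C)).
  apply: continuous_comp; [exact: inter_val_continuous|exact: cvg_fst].
exact: emb0_continuous.
Qed.

Definition inter_couple : compatible_couple V X0 inter_space :=
  CompatibleCouple (emb0 := emb0 C) (emb1 := inter_emb)
    (@emb0_inj _ _ _ _ C) inter_emb_inj
    (@emb0_continuous _ _ _ _ C) inter_emb_continuous
    (@ambient_hausdorff _ _ _ _ C).

End intersection.

Section sum.
Context {R : realType} {V : topologicalLmodType R}.
Context {X0 X1 : completeNormedModType R} (C : compatible_couple V X0 X1).

Definition decompositions (f : V) : set (X0 * X1) :=
  [set p | f = emb0 C p.1 + emb1 C p.2].

Definition sum_pred : {pred V} := fun f => `[< decompositions f !=set0 >].

Fact sum_submod_closed : submod_closed sum_pred.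
Proof.
split; first by apply/asboolP; exists 0; rewrite /decompositions /= !linear0 addr0.
move=> k f g /asboolP[p fp] /asboolP[q gq]; apply/asboolP; exists (k *: p + q).
by rewrite /decompositions /= !linearP fp gq scalerDr addrACA.
Qed.

HB.instance Definition _ :=
  GRing.isSubmodClosed.Build R V sum_pred sum_submod_closed.

Record sum_space := SumSpace { sum_val : V; sum_valP : sum_val \in sum_pred }.

HB.instance Definition _ := [isSub for sum_val].
HB.instance Definition _ := [Choice of sum_space by <:].
HB.instance Definition _ := [SubChoice_isSubLmodule of sum_space by <:].

(* Meaningful for f in the sum only: elsewhere the infimum is over the empty
   set. *)
Definition K_functional (f : V) (t : R) : R :=
  inf [set `|p.1| + t * `|p.2| | p in decompositions f].

Definition sum_norm (f : sum_space) : R :=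
  inf [set `|p.1| + `|p.2| | p in decompositions (sum_val f)].

Let size (p : X0 * X1) : R := `|p.1| + `|p.2|.

Let size_ge0 p : 0 <= size p. Proof. by rewrite addr_ge0. Qed.

Let has_lb (f : V) : has_lbound [set size p | p in decompositions f].
Proof. by exists 0 => _ [p _ <-]. Qed.

Let has_inf (f : sum_space) :
  has_inf [set size p | p in decompositions (sum_val f)].
Proof.
split; last exact: has_lb.
by have /asboolP[p fp] := sum_valP f; exists (size p), p.
Qed.

Fact sum_normD f g : sum_norm (f + g) <= sum_norm f + sum_norm g.
Proof.
apply/ler_addgt0Pr => e e0.
have e20 : 0 < e / 2 by rewrite divr_gt0.
have [_ [p fp <-] lep] := inf_adherent e20 (has_inf f).
have [_ [q gq <-] leq] := inf_adherent e20 (has_inf g).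
have fgpq : decompositions (sum_val (f + g)) (p + q).
  by rewrite /decompositions /= !linearD fp gq addrACA.
apply: (@le_trans _ _ (size (p + q))).
  by apply: (ge_inf (has_lb _)); exists (p + q).
apply: (@le_trans _ _ (size p + size q)).
  by rewrite /size /= addrACA lerD // ler_normD.
by apply: le_trans (lerD (ltW lep) (ltW leq)) _; rewrite addrACA -splitr.
Qed.

Let sum_normZ_le (k : R) f : sum_norm (k *: f) <= `|k| * sum_norm f.
Proof.
apply/ler_addgt0Pr => e e0.
have k0 : 0 < `|k| + 1 by rewrite ltr_wpDl.
have ek0 : 0 < e / (`|k| + 1) by rewrite divr_gt0.
have [_ [p fp <-] lep] := inf_adherent ek0 (has_inf f).
apply: (@le_trans _ _ (size (k *: p))).
  apply: (ge_inf (has_lb _)); exists (k *: p) => //.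
  by rewrite /decompositions /= !linearZ -scalerDr -fp.
rewrite /size /= !normrZ -mulrDr.
apply: (@le_trans _ _ (`|k| * (sum_norm f + e / (`|k| + 1)))).
  by rewrite ler_wpM2l // ltW.
rewrite mulrDr lerD2l mulrCA -[leRHS]mulr1 ler_pM2l //.
by rewrite ler_pdivrMr // mul1r lerDl.
Qed.

Fact sum_normZ (k : R) f : sum_norm (k *: f) = `|k| * sum_norm f.
Proof.
have [->|k0] := eqVneq k 0.
  rewrite normr0 mul0r scale0r; apply/eqP; rewrite eq_le; apply/andP; split.
    by rewrite -(scale0r 0) (le_trans (sum_normZ_le _ _))// normr0 mul0r.
  by apply: lb_le_inf; [exact: (has_inf 0).1|move=> _ [p _ <-]].
apply/eqP; rewrite eq_le sum_normZ_le /=.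
rewrite -ler_pdivlMl ?normr_gt0// -normfV.
by rewrite -{1}(scalerK k0 f) sum_normZ_le.
Qed.

Fact sum_norm0_eq0 f : sum_norm f = 0 -> f = 0.
Proof.
move=> f0.
have /choice[p pP] n : exists p, decompositions (sum_val f) p /\
    size p < n.+1%:R^-1.
  have n0 : 0 < n.+1%:R^-1 :> R by rewrite invr_gt0.
  have [_ [q fq <-]] := inf_adherent n0 (has_inf f).
  by rewrite (_ : inf _ = 0) // add0r => qn; exists q.
have cv (E : normedModType R) (h : X0 * X1 -> E) :
    (forall q, `|h q| <= size q) -> h (p n) @[n --> \oo] --> (0 : E).
  move=> hs; apply/cvgr0Pnorm_lt => e e0; near=> n.
  apply: (le_lt_trans (hs _)); apply: (lt_trans (pP n).2).
  near: n; exact: near_infty_natSinv_lt (PosNum e0).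
have cv0 : emb0 C (p n).1 @[n --> \oo] --> emb0 C 0.
  apply: (cvg_comp _ _ (cv _ fst _) (@emb0_continuous _ _ _ _ C 0)) => q.
  by rewrite lerDl.
have cv1 : emb1 C (p n).2 @[n --> \oo] --> emb1 C 0.
  apply: (cvg_comp _ _ (cv _ snd _) (@emb1_continuous _ _ _ _ C 0)) => q.
  by rewrite lerDr.
have cvf : emb0 C (p n).1 + emb1 C (p n).2 @[n --> \oo] --> (0 : V).
  have <- : emb0 C 0 + emb1 C 0 = 0 by rewrite !linear0 addr0.
  exact: (cvg_comp2 cv0 cv1 (@add_continuous V (emb0 C 0, emb1 C 0))).
apply: val_inj; apply: (cvg_unique (ambient_hausdorff C) _ cvf).
rewrite (_ : (fun n => _) = cst (sum_val f)); first exact: cvg_cst.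
by apply/funext => n; rewrite -(pP n).1.
Unshelve. all: by end_near. Qed.

HB.instance Definition _ := Lmodule_isNormed.Build R sum_space
  sum_normD sum_normZ sum_norm0_eq0.

End sum.

Definition pos_half_line (R : realType) : set R := `]0, +oo[.
Arguments pos_half_line {R}.

Definition L1_norm (R : realType) (g : R -> R) : \bar R :=
  \int[lebesgue_measure]_(t in pos_half_line) `|g t|%:E.

(* A linear subset of V with a norm; the value of the norm outside the carrier
   is irrelevant. *)
Record normed_subset (R : realType) (V : Type) := NormedSubset {
  carrier : set V;
  subset_norm : V -> \bar R
}.

Definition equal_spaces (R : realType) (V : Type) (E F : normed_subset R V) :=
  carrier E = carrier F /\
  exists c1 c2 : R, [/\ 0 < c1, 0 < c2 &
    forall f, carrier E f ->
      (c1%:E * subset_norm E f <= subset_norm F f)%E /\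
      (subset_norm F f <= c2%:E * subset_norm E f)%E].

Section interpolation.
Context {R : realType} {V : topologicalLmodType R}.
Context {X0 X1 : completeNormedModType R} (C : compatible_couple V X0 X1).

Definition J_functional (x : inter_space C) (t : R) : R :=
  Num.max `|(inter_val x).1| (t * `|(inter_val x).2|).

Fact inter_sub_sum (x : inter_space C) :
  emb0 C (inter_val x).1 \in sum_pred C.
Proof.
apply/asboolP; exists ((inter_val x).1, 0).
by rewrite /decompositions /= linear0 addr0.
Qed.

Definition inter_to_sum (x : inter_space C) : sum_space C :=
  SumSpace (inter_sub_sum x).

Definition K_norm (v : R -> R) (f : V) : \bar R :=
  L1_norm (fun t => t^-1 * v t * K_functional C f t).

Definition K_space (v : R -> R) : normed_subset R V :=
  NormedSubset [set f | f \in sum_pred C /\ (K_norm v f < +oo)%E] (K_norm v).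

Definition J_representation (f : V) (u : R -> inter_space C) : Prop :=
  strongly_measurable lebesgue_measure pos_half_line u /\
  exists2 z : sum_space C, sum_val z = f &
    is_bochner_integral lebesgue_measure pos_half_line
      (fun s => s^-1 *: inter_to_sum (u s)) z.

Definition J_norm (v : R -> R) (f : V) : \bar R :=
  ereal_inf [set L1_norm (fun t => t^-1 * v t * J_functional (u t) t)
            | u in J_representation f].

Definition J_space (v : R -> R) : normed_subset R V :=
  NormedSubset
    [set f | [/\ f \in sum_pred C, J_representation f !=set0 &
                 (J_norm v f < +oo)%E]]
    (J_norm v).

End interpolation.

Section weights.
Context {R : realType}.
Implicit Types f g b : R -> R.

(* The measurable sets of R in the library are the Borel sets; here they are
   completed by the null sets. *)
Definition lebesgue_measurable_fun f : Prop :=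
  measurable_fun (pos_half_line :
      set (g_sigma_algebraType (completed_algebra_gen (@lebesgue_measure R))))
    f.

Definition equivalent f g : Prop :=
  exists c1 c2 : R, [/\ 0 < c1, 0 < c2 &
    forall t : R, 0 < t -> f t <= c1 * g t /\ g t <= c2 * f t].

Definition slowly_varying b : Prop :=
  [/\ forall t : R, 0 < t -> 0 < b t,
      lebesgue_measurable_fun b &
      forall e : R, 0 < e ->
        (exists g, [/\ forall t : R, 0 < t -> 0 <= g t,
            {in pos_half_line &, {homo g : x y / x <= y}} &
            equivalent (fun t => t `^ e * b t) g]) /\
        (exists g, [/\ forall t : R, 0 < t -> 0 <= g t,
            {in pos_half_line &, {homo g : x y /~ x <= y}} &
            equivalent (fun t => t `^ (- e) * b t) g])].

Definition abs_continuous_on (x y : R) f : Prop :=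
  forall e : R, 0 < e -> exists2 d : R, 0 < d &
    forall (n : nat) (l r : 'I_n -> R),
      (forall i, x <= l i /\ l i <= r i /\ r i <= y) ->
      trivIset setT (fun i => `]l i, r i[%classic) ->
      \sum_(i < n) (r i - l i) < d ->
      \sum_(i < n) `|f (r i) - f (l i)| < e.

Definition locally_abs_continuous f : Prop :=
  forall x y : R, 0 < x -> x <= y -> abs_continuous_on x y f.

Definition strictly_decreasing f : Prop :=
  {in pos_half_line &, {homo f : x y /~ x < y}}.

End weights.

(* Main.v *)
From HB Require Import structures.
Require Import Defs.
From mathcomp Require Import all_boot all_order all_algebra.
From mathcomp Require Import all_classical all_reals all_analysis.
From mathcomp Require Import finmap measurable_realfun ring lra.

Set Implicit Arguments.
Unset Strict Implicit.
Unset Printing Implicit Defensive.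

Import Order.TTheory GRing.Theory Num.Theory.
Import numFieldNormedType.Exports.

Local Open Scope classical_set_scope.
Local Open Scope ring_scope.

(** Let Y be the intersection of X0 and X1, let K(f, t) be the K-functional of the
    couple (X0, Y), and let h = - A', so that B(t) = t h(t) and the norm of the
    K-space is the integral of h(t) K(f, t). Both J-spaces are shown to embed into
    this K-space and to contain it, which yields both equalities.

    From a J-space to the K-space. Let f be the integral of u(s) ds / s. Assigning
    u(s) to X0 where its X0 norm p(s) is at most t times its Y norm q(s), and to Y
    elsewhere, splits f and gives
      K(f, t) <= integral of min(p(s), t q(s)) ds / s,
    which is K_inter_le_integral. By Tonelli's theorem (integral_K_inter_le) it
    remains to bound, for fixed p and q, the integral of h(t) min(p, t q); it is at
    most C A(r) max(p, r q) for every r > 0 (density_kernel_le), because a slowly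
    varying A satisfies t h(t) dt = O(s A(s)) when integrated over (0, s). For the
    couple (X0, Y) one takes r = s, for (X0, X1) one takes r = min(1, s), since a is
    bounded and bounded away from 0 on (1, oo).

    From the K-space to a J-space. The density h may be much smaller than A(s) / s,
    so that the usual splitting of f along powers of 2 costs too much. Instead f is
    split at the points where A doubles (exists_step_representation): between two
    of them the mass of h is comparable to A itself, which turns the integral of
    h K into the sum that bounds the norm of the representation. For t >= 1 the
    K-functional is the norm of X0, so that all pieces can be put in (0, 1], where
    a = A and where the J-functional of (X0, X1) is at most that of (X0, Y): the
    same representation serves both J-spaces.

    Two tools come first: the Bochner integral, which exists for absolutely
    integrable strongly measurable functions with values in a Banach space
    (bochner_exists), and the fact that a decreasing locally absolutely continuous
    function is the integral of its derivative
    (nonincreasing_locally_abs_continuous_density), obtained from the Radon-Nikodym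
    and Lebesgue differentiation theorems. *)

(** * Integrals of arbitrary non-negative functions, simple functions *)

Section lower_integral.
Local Open Scope ereal_scope.
Context d (T : measurableType d) (R : realType).
Variables (mu : {measure set T -> \bar R}) (D : set T).
Implicit Types f g : T -> \bar R.

Import HBNNSimple.

(** The integral of a non-negative function is the supremum of the integrals of
    the simple functions below it, whether or not the function is measurable.
    Hence monotonicity and invariance under modification on a null set hold for
    all non-negative functions; integrands built from strongly measurable
    functions or from a derivative are measurable off a null set only. *)
Lemma lower_integral_le f g : (forall x, D x -> 0 <= f x) ->
  (forall x, D x -> f x <= g x) ->
  \int[mu]_(x in D) f x <= \int[mu]_(x in D) g x.
Proof.
move=> f0 fg; have g0 x : D x -> 0 <= g x.
  by move=> Dx; rewrite (le_trans (f0 x Dx))// fg.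
rewrite !ge0_integralE// ge_ereal_sup// => _ [h /= hf <-].
by apply: ereal_sup_ubound; exists h => // x; rewrite (le_trans (hf x))// lee_restrict.
Qed.

Lemma lower_integral_ae_le f g :
  (forall x, D x -> 0 <= f x) -> (forall x, D x -> 0 <= g x) ->
  {ae mu, forall x, D x -> f x <= g x} ->
  \int[mu]_(x in D) f x <= \int[mu]_(x in D) g x.
Proof.
move=> f0 g0 [N [mN N0 fgN]].
rewrite [leLHS]ge0_integralE// ge_ereal_sup// => _ [h /= hf <-].
rewrite -integralT_nnsfun (ge0_negligible_integral mN)//; last 2 first.
- by apply/measurable_EFinP; exact: measurable_funPT.
- by move=> x _; rewrite lee_fin fun_ge0.
rewrite setTD integral_mkcond [leRHS]integral_mkcond.
rewrite !ge0_integralTE; last 2 first.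
- by apply: erestrict_ge0.
- by apply: erestrict_ge0 => x _; rewrite lee_fin fun_ge0.
apply: le_ereal_sup => _ [k /= kh <-]; exists k => // x.
apply: (le_trans (kh x)); rewrite /patch; case: ifPn => xN; last first.
  by case: ifPn => // /set_mem /g0.
have := hf x; rewrite /patch; case: ifPn => xD hfx; last exact: hfx.
apply: (le_trans hfx); have := set_mem xN; apply: contra_notP => fg.
by apply: fgN => /= H; apply: fg; apply: H; exact: set_mem.
Qed.

Lemma lower_integral_ae_eq f g :
  (forall x, D x -> 0 <= f x) -> (forall x, D x -> 0 <= g x) ->
  {ae mu, forall x, D x -> f x = g x} ->
  \int[mu]_(x in D) f x = \int[mu]_(x in D) g x.
Proof.
move=> f0 g0 fg; apply/eqP; rewrite eq_le; apply/andP; split;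
  by apply: lower_integral_ae_le => //; apply: filterS fg => x H Dx; rewrite H.
Qed.

Definition almost_measurable f := exists N,
  [/\ measurable N, mu N = 0 & measurable_fun (D `\` N) f].

Hypothesis mD : measurable D.

Lemma lower_integral_setD N f : measurable N -> mu N = 0 ->
  (forall x, D x -> 0 <= f x) ->
  \int[mu]_(x in D) f x = \int[mu]_(x in D `\` N) f x.
Proof.
move=> mN N0 f0; rewrite setDE integral_mkcondr.
apply: lower_integral_ae_eq => //.
  by move=> x Dx; rewrite /patch; case: ifPn => // _; exact: f0.
exists N; split=> // x /=; apply: contra_notP => Nx Dx.
by rewrite /patch mem_set.
Qed.

Lemma lower_integralD f g :
  (forall x, D x -> 0 <= f x) -> (forall x, D x -> 0 <= g x) ->
  almost_measurable f -> almost_measurable g ->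
  \int[mu]_(x in D) (f x + g x) =
  \int[mu]_(x in D) f x + \int[mu]_(x in D) g x.
Proof.
move=> f0 g0 [N [mN N0 mf]] [M [mM M0 mg]].
have mNM : measurable (N `|` M) by exact: measurableU.
have NM0 : mu (N `|` M) = 0 by rewrite measureU0.
have S1 : D `\` (N `|` M) `<=` D `\` N by apply: setDS; exact: subsetUl.
have S2 : D `\` (N `|` M) `<=` D `\` M by apply: setDS; exact: subsetUr.
rewrite !(lower_integral_setD mNM NM0)//; last first.
  by move=> x Dx; rewrite adde_ge0 ?f0 ?g0.
rewrite ge0_integralD//.
- exact: measurableD.
- by move=> x [/f0].
- by apply: measurable_funS mf => //; exact: measurableD.
- by move=> x [/g0].
- by apply: measurable_funS mg => //; exact: measurableD.
Qed.

End lower_integral.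

Section simple_functions.
Context d (T : measurableType d) (R : realType).
Variables (mu : {measure set T -> \bar R}) (D : set T).
Hypothesis mD : measurable D.

Lemma simple_on_preimage (E : normedModType R) (s : T -> E) (A : set E) :
  simple_on D s -> measurable (D `&` s @^-1` A).
Proof.
move=> [fs ms]; rewrite (_ : _ `&` _ =
    \big[setU/set0]_(y <- fset_set (s @` D `&` A)) (D `&` s @^-1` [set y])).
  exact: bigsetU_measurable.
rewrite bigsetU_fset_set; last exact: finite_setIl.
apply/seteqP; split => x /=.
  by move=> [Dx Ax]; exists (s x) => //; split => //; exists x.
by move=> [y [_ Ay]] [Dx ->].
Qed.

Lemma simple_on_comp (E F : normedModType R) (phi : E -> F) (s : T -> E) :
  simple_on D s -> simple_on D (phi \o s).
Proof.
move=> [fs ms]; split; first by rewrite -image_comp; exact: finite_image.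
by move=> y; rewrite comp_preimage; exact: simple_on_preimage.
Qed.

Lemma simple_on_pair (E F : normedModType R) (s : T -> E) (s' : T -> F) :
  simple_on D s -> simple_on D s' -> simple_on D (fun x => (s x, s' x)).
Proof.
move=> [fs ms] [fs' ms']; split.
  apply: (sub_finite_set _ (finite_setX fs fs')) => _ [x Dx <-] /=.
  by split; exists x.
move=> [y y']; rewrite (_ : _ `&` _ =
    (D `&` s @^-1` [set y]) `&` (D `&` s' @^-1` [set y'])).
  exact: measurableI.
by apply/seteqP; split => x /= => [[Dx [-> ->]]|[[Dx ->] [_ ->]]].
Qed.

Lemma simple_on_measurable (s : T -> R) : simple_on D s -> measurable_fun D s.
Proof. by move=> ss _ A _; exact: simple_on_preimage. Qed.

Definition integrable_simple (E : normedModType R) (s : T -> E) :=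
  simple_on D s /\
  forall y, y != 0 -> (mu (D `&` s @^-1` [set y]) < +oo)%E.

Lemma integrable_simple_pair (E F : normedModType R) (s : T -> E) (s' : T -> F) :
  integrable_simple s -> integrable_simple s' ->
  integrable_simple (fun x => (s x, s' x)).
Proof.
move=> [ss fs] [ss' fs']; split; first exact: simple_on_pair.
move=> [y y'] yy'0.
have mss' := simple_on_preimage [set (y, y')] (simple_on_pair ss ss').
have [y0|y0] := eqVneq y 0.
  have y'0 : y' != 0 by apply: contra_neq yy'0 => ->; rewrite y0.
  have /le_lt_trans : (mu (D `&` (fun x => (s x, s' x)) @^-1` [set (y, y')]) <=
      mu (D `&` s' @^-1` [set y']))%E.
    apply: le_measure; [exact: mem_set|exact/mem_set/ss'.2|].
    by move=> x [Dx [_ <-]].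
  by apply; exact: fs'.
have /le_lt_trans : (mu (D `&` (fun x => (s x, s' x)) @^-1` [set (y, y')]) <=
    mu (D `&` s @^-1` [set y]))%E.
  apply: le_measure; [exact: mem_set|exact/mem_set/ss.2|].
  by move=> x [Dx [<- _]].
by apply; exact: fs.
Qed.

(** The level sets of a composition are unions of level sets; applied to pairs,
    this gives the additivity of the integral of simple functions. *)
Lemma level_set_comp (E F : normedModType R) (phi : E -> F) (s : T -> E) z :
  simple_on D s ->
  mu (D `&` (phi \o s) @^-1` [set z]) =
  (\sum_(y \in s @` D `&` phi @^-1` [set z]) mu (D `&` s @^-1` [set y]))%E.
Proof.
move=> [fs ms]; rewrite -measure_fin_bigcup//.
- congr (mu _); apply/seteqP; split => x /=.
    by move=> [Dx sx]; exists (s x) => //; split => //; exists x.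
  by move=> [y [_ yz]] [Dx sxy]; split=> //; rewrite sxy.
- exact: finite_setIl.
- exact/trivIset_setIl/trivIset_preimage1.
Qed.

Lemma integrable_simple_comp (E F : normedModType R) (phi : E -> F) (s : T -> E) :
  phi 0 = 0 -> integrable_simple s -> integrable_simple (phi \o s).
Proof.
move=> phi0 [ss fins]; split; first exact: simple_on_comp ss.
move=> z z0; rewrite level_set_comp// fsbig_finite; last exact/finite_setIl/ss.1.
rewrite /= big_seq; apply: lte_sum_pinfty => y.
rewrite in_fset_set; last exact/finite_setIl/ss.1.
move=> /set_mem[_ yz]; apply: fins; apply: contra_neq z0 => y0.
by rewrite -yz y0.
Qed.

Lemma partition_fsbig (I J : choiceType) (V : nmodType) (A : set I) (h : I -> J)
    (F : I -> V) : finite_set A ->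
  \sum_(i \in A) F i = \sum_(j \in h @` A) \sum_(i \in A `&` h @^-1` [set j]) F i.
Proof.
move=> finA; rewrite fsbig_finite//= fsbig_finite; last exact: finite_image.
rewrite /= fset_set_image// (partition_big_imfset _ h)/=; apply: eq_bigr => j _.
rewrite fsbig_mkcondr fsbig_finite//= big_mkcond/=; apply: eq_bigr => i _.
rewrite /patch; case: ifPn => [/eqP hij|hij].
  by rewrite mem_set.
by rewrite memNset// => /eqP; exact/negP.
Qed.

Lemma simple_integral_comp (E F : normedModType R) (phi : E -> F) (s : T -> E) :
  phi 0 = 0 -> integrable_simple s ->
  simple_integral mu D (phi \o s) =
  \sum_(y \in s @` D) fine (mu (D `&` s @^-1` [set y])) *: phi y.
Proof.
move=> phi0 is_s; have [[fs ms] fins] := is_s.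
rewrite (partition_fsbig phi)// /simple_integral image_comp.
apply: eq_fsbigr => z _; have [->|z0] := eqVneq z 0.
  rewrite scaler0 fsbig1// => y [_ /= ->]; exact: scaler0.
have finz : finite_set (s @` D `&` phi @^-1` [set z]) by exact: finite_setIl.
transitivity (\sum_(y \in s @` D `&` phi @^-1` [set z])
    fine (mu (D `&` s @^-1` [set y])) *: z); last first.
  by apply: eq_fsbigr => y /set_mem[_ /= ->].
rewrite level_set_comp// !fsbig_finite//= -scaler_suml; congr (_ *: _).
rewrite big_seq [RHS]big_seq sum_fine// => y.
rewrite in_fset_set// => /set_mem[_ /= yz].
rewrite ge0_fin_numE//; apply: fins; apply: contra_neq z0 => y0.
by rewrite -yz y0.
Qed.

Lemma integrable_simpleD (E : normedModType R) (s s' : T -> E) :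
  integrable_simple s -> integrable_simple s' ->
  integrable_simple (fun x => s x + s' x) /\
  simple_integral mu D (fun x => s x + s' x) =
    simple_integral mu D s + simple_integral mu D s'.
Proof.
move=> is_s is_s'; have is_p := integrable_simple_pair is_s is_s'.
set p := (fun x => _) in is_p.
pose add (y : E * E) := y.1 + y.2.
have add0 : add 0 = 0 by exact: addr0.
split; first exact: (integrable_simple_comp add0 is_p).
rewrite (simple_integral_comp add0 is_p).
rewrite (simple_integral_comp (erefl : fst 0 = 0) is_p).
rewrite (simple_integral_comp (erefl : snd 0 = 0) is_p).
have finp := is_p.1.1.
by rewrite !fsbig_finite//= -big_split; apply: eq_bigr => y _; rewrite scalerDr.
Qed.

Lemma simple_integral_linear (E F : normedModType R) (L : {linear E -> F})
    (s : T -> E) : integrable_simple s ->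
  simple_integral mu D (L \o s) = L (simple_integral mu D s).
Proof.
move=> is_s; rewrite (simple_integral_comp (linear0 L) is_s).
have fins := is_s.1.1.
by rewrite /simple_integral !fsbig_finite//= linear_sum; apply: eq_bigr => y _;
  rewrite linearZ.
Qed.

Lemma simple_integral_norm (E : normedModType R) (s : T -> E) :
  integrable_simple s ->
  (`|simple_integral mu D s|%:E <= \int[mu]_(x in D) `|s x|%:E)%E.
Proof.
move=> [[fs ms] fins].
rewrite (_ : (\int[mu]_(x in D) _)%E = (\sum_(y \in s @` D)
    `|y|%:E * mu (D `&` s @^-1` [set y]))%E); last first.
  transitivity (\int[mu]_(x in D) \sum_(y \in s @` D)
      (`|y|%:E * (\1_(D `&` s @^-1` [set y]) x)%:E))%E.
    apply: eq_integral => x /set_mem Dx.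
    rewrite (fsbigD1 (s x))//=; last by exists x.
    rewrite indicE mem_set// mule1 fsbig1 ?adde0// => y [_ /= ys].
    by rewrite indicE memNset ?mule0// => -[_ /= sxy]; exact: ys.
  rewrite ge0_integral_fsum//; last first.
    move=> y; apply: measurable_funeM.
    by apply/measurable_EFinP; exact/measurable_indic/ms.
  apply: eq_fsbigr => y _; rewrite ge0_integralZl//; last first.
    by apply/measurable_EFinP; exact/measurable_indic/ms.
  by rewrite integral_indic// setIAC setIid.
rewrite /simple_integral !fsbig_finite//=.
apply: (@le_trans _ _ (\sum_(y <- fset_set (s @` D))
    `|fine (mu (D `&` s @^-1` [set y])) *: y|)%:E).
  by rewrite lee_fin ler_norm_sum.
rewrite -sumEFin; apply: lee_sum => y _; rewrite normrZ mulrC EFinM.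
have [->|y0] := eqVneq y 0; first by rewrite normr0 !mul0e.
rewrite lee_pmul2l// ?lte_fin ?normr_gt0//.
by rewrite ger0_norm ?fine_ge0// fineK// ge0_fin_numE// fins.
Qed.

End simple_functions.

(** * The Bochner integral *)

Lemma contraction_continuous (R : realType) (E F : normedModType R)
    (L : {linear E -> F}) : (forall y, `|L y| <= `|y|) -> continuous L.
Proof.
move=> L1; apply/linear_bounded_continuous/linear_boundedP.
by near=> r => y; rewrite (le_trans (L1 y))// ler_peMl.
Unshelve. all: by end_near. Qed.

Section bochner_integral.
Import HBSimple.
Context d (T : measurableType d) (R : realType).
Variables (mu : {measure set T -> \bar R}) (D : set T).
Hypothesis mD : measurable D.

Local Notation smeas := (strongly_measurable mu D).

Lemma simple_on_strongly_measurable (E : normedModType R) (s : T -> E) :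
  simple_on D s -> smeas s.
Proof.
by move=> ss; exists (fun=> s); split => //; apply: aeW => x _; exact: cvg_cst.
Qed.

Lemma strongly_measurable_pair (E F : normedModType R) (u : T -> E) (v : T -> F) :
  smeas u -> smeas v -> smeas (fun x => (u x, v x)).
Proof.
move=> [s [ss su]] [t [st tv]]; exists (fun n x => (s n x, t n x)); split.
  by move=> n; exact: simple_on_pair.
by apply: filterS2 su tv => x sx tx Dx; apply: cvg_pair; [exact: sx|exact: tx].
Qed.

Lemma strongly_measurable_comp (E F : normedModType R) (phi : E -> F) (u : T -> E) :
  continuous phi -> smeas u -> smeas (phi \o u).
Proof.
move=> cphi [s [ss su]]; exists (fun n => phi \o s n); split.
  by move=> n; exact: simple_on_comp.
by apply: filterS su => x sx Dx; apply: continuous_cvg; [exact: cphi|exact: sx].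
Qed.

Lemma strongly_measurableD (E : normedModType R) (u v : T -> E) :
  smeas u -> smeas v -> smeas (fun x => u x + v x).
Proof.
move=> su sv.
have := strongly_measurable_comp _ (strongly_measurable_pair su sv).
by move=> /(_ _ (fun y : E * E => y.1 + y.2)); apply => y; exact: add_continuous.
Qed.

Lemma strongly_measurableN (E : normedModType R) (u : T -> E) :
  smeas u -> smeas (fun x => - u x).
Proof. by apply: strongly_measurable_comp; exact: opp_continuous. Qed.

Lemma strongly_measurable_fun (f : T -> R) : measurable_fun D f ->
  smeas (f : T -> R^o).
Proof.
move=> mf; have := approximation_sfun mD ((measurable_EFinP D f).2 mf).
move=> [g gf]; exists (fun n x => g n x); split.
  move=> n; split; first by apply: sub_finite_set (fimfunP (g n)) => _ [x _ <-]; exists x.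
  by move=> y; apply: measurableI => //; rewrite -[X in measurable X]setTI;
    exact: measurable_funPT.
apply: aeW => x Dx; by apply: fine_cvg (gf x Dx).
Qed.

Lemma strongly_measurableZ (E : normedModType R) (f : T -> R) (u : T -> E) :
  measurable_fun D f -> smeas u -> smeas (fun x => f x *: u x).
Proof.
move=> mf su.
have := strongly_measurable_comp _
  (strongly_measurable_pair (strongly_measurable_fun mf) su).
move=> /(_ _ (fun y : R^o * E => y.1 *: y.2)); apply => y.
exact: scale_continuous.
Qed.

Lemma measurable_norm_lim (E : normedModType R) (s : nat -> T -> E) u (M : set T) :
  M `<=` D -> (forall n, simple_on D (s n)) ->
  (forall x, M x -> s n x @[n --> \oo] --> u x) ->
  measurable_fun M (fun x => `|u x|).
Proof.
move=> MD ss su; apply: (@measurable_fun_cvg _ _ _ _ (fun n x => `|s n x|)).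
  move=> n; apply: (measurable_funS mD MD).
  by have := simple_on_measurable
    (simple_on_comp (fun y => `|y| : R^o) (ss n)).
by move=> x Mx; apply: cvg_norm; exact: su.
Qed.

Lemma strongly_measurable_norm (E : normedModType R) (u : T -> E) :
  smeas u -> almost_measurable mu D (fun x => `|u x|%:E).
Proof.
move=> [s [ss [N [mN N0 sN]]]]; exists N; split => //.
apply/measurable_EFinP; apply: (measurable_norm_lim _ ss); first exact: subDsetl.
move=> x [Dx]; apply: contra_notP => xs.
by apply: sN => /= H; apply: xs; exact: H.
Qed.

Local Open Scope ereal_scope.

Lemma ge0_norm (E : normedModType R) (u : T -> E) x : 0 <= `|u x|%:E.
Proof. by rewrite lee_fin. Qed.
Local Hint Resolve ge0_norm : core.

Lemma bochner_strongly_measurable (E : normedModType R) (u : T -> E) z :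
  is_bochner_integral mu D u z -> smeas u.
Proof. by move=> [s [ss _ su _ _]]; exists s; split. Qed.

Lemma bochner_norm_le (E : normedModType R) (u : T -> E) z :
  is_bochner_integral mu D u z -> `|z|%:E <= \int[mu]_(x in D) `|u x|%:E.
Proof.
move=> bu; have su := bochner_strongly_measurable bu.
have [s [ss fs _ us sz]] := bu.
have [->|I_fin] := eqVneq (\int[mu]_(x in D) `|u x|%:E) +oo; first by rewrite leey.
have Ifin : \int[mu]_(x in D) `|u x|%:E \is a fin_num.
  by rewrite ge0_fin_numE ?integral_ge0// ltey.
have c1 : `|simple_integral mu D (s n)|%:E @[n --> \oo] --> `|z|%:E.
  by apply: cvg_EFin; [exact: nearW|exact: cvg_norm sz].
have c2 : \int[mu]_(x in D) `|u x|%:E + \int[mu]_(x in D) `|u x - s n x|%:E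
    @[n --> \oo] --> \int[mu]_(x in D) `|u x|%:E.
  rewrite -[X in _ --> X]adde0; apply: cvgeD us; last exact: cvg_cst.
  exact: fin_num_adde_defr.
rewrite -(cvg_lim _ c1)// -(cvg_lim _ c2)//; apply: lee_lim.
- by apply/cvg_ex; exists `|z|%:E.
- by apply/cvg_ex; exists (\int[mu]_(x in D) `|u x|%:E).
apply: nearW => n; apply: (le_trans (simple_integral_norm mD _)).
  by split; [exact: ss|exact: fs].
rewrite -lower_integralD//; last 2 first.
- exact: strongly_measurable_norm.
- apply: strongly_measurable_norm; apply: strongly_measurableD => //.
  exact/strongly_measurableN/simple_on_strongly_measurable.
apply: lower_integral_le => // x _; rewrite -EFinD lee_fin.
by rewrite -{1}(subKr (u x) (s n x)) (le_trans (ler_normB _ _)).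
Qed.

Lemma bochnerD (E : normedModType R) (u v : T -> E) y z :
  is_bochner_integral mu D u y -> is_bochner_integral mu D v z ->
  is_bochner_integral mu D (fun x => u x + v x)%R (y + z)%R.
Proof.
move=> bu bv; have su := bochner_strongly_measurable bu.
have sv := bochner_strongly_measurable bv.
have [s [ss fs cs us sy]] := bu; have [t [st ft ct vt tz]] := bv.
have iD n := integrable_simpleD (conj (ss n) (fs n)) (conj (st n) (ft n)).
exists (fun n x => s n x + t n x)%R; split.
- by move=> n; exact: (iD n).1.1.
- by move=> n; exact: (iD n).1.2.
- by apply: filterS2 cs ct => x sx tx Dx; apply: cvgD; [exact: sx|exact: tx].
- have := cvgeD _ us vt; rewrite adde0 => /(_ _ isT) usvt.
  apply: (squeeze_cvge _ (cvg_cst _) usvt); apply: nearW => n.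
  rewrite integral_ge0//=.
  rewrite -lower_integralD//; last 2 first.
  + apply: strongly_measurable_norm; apply: strongly_measurableD => //.
    exact/strongly_measurableN/simple_on_strongly_measurable.
  + apply: strongly_measurable_norm; apply: strongly_measurableD => //.
    exact/strongly_measurableN/simple_on_strongly_measurable.
  apply: lower_integral_le => // x _; rewrite -EFinD lee_fin opprD addrACA.
  exact: ler_normD.
- under eq_fun do rewrite (iD _).2.
  exact: cvgD.
Qed.

Lemma bochner_contraction (E F : normedModType R) (L : {linear E -> F})
    (u : T -> E) z : (forall y, `|L y| <= `|y|)%R ->
  is_bochner_integral mu D u z -> is_bochner_integral mu D (L \o u) (L z).
Proof.
move=> L1 bu; have [s [ss fs cs us sz]] := bu.
have cL : continuous L by exact: contraction_continuous.
have iL n := simple_integral_linear L (conj (ss n) (fs n)).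
have isL n := integrable_simple_comp (linear0 L) (conj (ss n) (fs n)).
exists (fun n => L \o s n); split.
- by move=> n; exact: (isL n).1.
- by move=> n; exact: (isL n).2.
- by apply: filterS cs => x sx Dx; apply: continuous_cvg; [exact: cL|exact: sx].
- apply: (squeeze_cvge _ (cvg_cst _) us); apply: nearW => n.
  rewrite integral_ge0//=.
  by apply: lower_integral_le => // x _; rewrite lee_fin -linearB.
- under eq_fun do rewrite iL.
  by apply: continuous_cvg => //; exact: cL.
Qed.

Lemma bochnerN (E : normedModType R) (u : T -> E) z :
  is_bochner_integral mu D u z ->
  is_bochner_integral mu D (fun x => - u x)%R (- z)%R.
Proof. by apply: (@bochner_contraction _ _ -%R) => y; rewrite normrN. Qed.

Lemma bochner_unique (E : normedModType R) (u : T -> E) y z :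
  is_bochner_integral mu D u y -> is_bochner_integral mu D u z -> y = z.
Proof.
move=> uy uz; apply/eqP; rewrite -subr_eq0 -normr_eq0 eq_le normr_ge0 andbT.
have := bochner_norm_le (bochnerD uy (bochnerN uz)).
rewrite integral0_eq ?lee_fin// => x _.
by rewrite subrr normr0.
Qed.

Lemma integrable_simple_norm (E : normedModType R) (s : T -> E) :
  simple_on D s -> \int[mu]_(x in D) `|s x|%:E < +oo -> integrable_simple mu D s.
Proof.
move=> ss sfin; split => // y y0.
have mL : measurable (D `&` s @^-1` [set y]) by exact: ss.2.
have : `|y|%:E * mu (D `&` s @^-1` [set y]) < +oo.
  apply: le_lt_trans sfin.
  rewrite -[X in mu X](setIidl (@subIsetl _ D (s @^-1` [set y]))) -integral_indic//.
  rewrite -ge0_integralZl//; last by apply/measurable_EFinP/measurable_indic.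
  apply: lower_integral_le => x Dx; first by rewrite mule_ge0.
  rewrite indicE; case: (boolP (x \in _)) => [/set_mem[_ /= ->]|_].
    by rewrite mule1.
  by rewrite mule0.
apply: contraTT; rewrite -!leNgt !leye_eq => /eqP ->.
by rewrite gt0_muley// lte_fin normr_gt0.
Qed.

Lemma simple_onZ_indic (E : normedModType R) (s : T -> E) (A : set T) :
  simple_on D s -> measurable A -> simple_on D (fun x => (\1_A x : R) *: s x)%R.
Proof.
move=> ss mA.
have sA : simple_on D (\1_A : T -> R^o).
  split; last first.
    by move=> y; exact: (@measurable_indic _ _ R D A mA mD _ (measurable_set1 y)).
  apply: (@sub_finite_set _ _ [set 0%R; 1%R]) => // _ [x _ <-]; rewrite indicE.
  by case: (x \in A); [right|left].
exact: (simple_on_comp (fun p : R^o * E => p.1 *: p.2)%R (simple_on_pair sA ss)).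
Qed.

(** Cutting the approximants off where they exceed twice the norm of the limit
    makes them dominated, so that dominated convergence applies. *)
Lemma bochner_exists (E : completeNormedModType R) (u : T -> E) :
  smeas u -> \int[mu]_(x in D) `|u x|%:E < +oo ->
  exists z, is_bochner_integral mu D u z.
Proof.
move=> [s [ss [N [mN N0 sN]]]] ufin.
pose M := D `\` N.
have mM : measurable M by exact: measurableD.
have MD : M `<=` D by exact: subDsetl.
have {}sN x : M x -> s n x @[n --> \oo] --> u x.
  move=> [Dx]; apply: contra_notP => xs.
  by apply: sN => /= H; apply: xs; exact: H.
have mu_ : measurable_fun M (fun x => `|u x|%:E).
  by apply/measurable_EFinP; exact: (measurable_norm_lim MD ss).
(* where s n x is at most twice as large as its limit *)
pose A n := M `&` [set x | `|s n x|%:E <= 2%:E * `|u x|%:E].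
have mA n : measurable (A n).
  apply: measurable_lee => //; last exact: measurable_funeM.
  apply/measurable_EFinP/(measurable_funS mD MD).
  by have := simple_on_measurable
    (simple_on_comp (fun y => `|y|%R : R^o) (ss n)).
pose t n x := ((\1_(A n) x : R) *: s n x)%R.
have st n : simple_on D (t n) by exact: simple_onZ_indic.
have t_le n x : (`|t n x| <= 2 * `|u x|)%R.
  rewrite /t indicE; case: (boolP (x \in A n)) => [/set_mem[_ /=]|_].
    by rewrite scale1r -EFinM lee_fin.
  by rewrite scale0r normr0 mulr_ge0.
have tu x : M x -> t n x @[n --> \oo] --> u x.
  move=> Mx; have [ux0|ux0] := eqVneq (u x) 0%R.
    rewrite ux0 [X in X @ _](_ : _ = cst 0%R); first exact: cvg_cst.
    apply/funext => n; have := t_le n x; rewrite ux0 normr0 mulr0.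
    by rewrite normr_le0 => /eqP.
  apply: cvg_trans (sN _ Mx); apply: near_eq_cvg; near=> n.
  rewrite /t indicE mem_set ?scale1r//; split => //=; rewrite -EFinM lee_fin.
  rewrite mulr_natl mulr2n -lerBlDr (le_trans (lerB_dist _ _))// ltW//.
  near: n; have /cvgrPdistC_lt := sN _ Mx; apply.
  by rewrite normr_gt0.
have u2fin : \int[mu]_(x in D) (2 * `|u x|)%:E < +oo.
  have -> : \int[mu]_(x in D) (2 * `|u x|)%:E =
      \int[mu]_(x in D) `|u x|%:E + \int[mu]_(x in D) `|u x|%:E.
    rewrite -lower_integralD//; last 2 first.
    - by exists N.
    - by exists N.
    by apply: eq_integral => x _; rewrite -EFinD mulr_natl mulr2n.
  exact: lte_add_pinfty.
have it n : integrable_simple mu D (t n).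
  apply: integrable_simple_norm => //; apply: le_lt_trans u2fin.
  by apply: lower_integral_le => // x _; rewrite lee_fin.
have cvg_dist : \int[mu]_(x in D) `|u x - t n x|%:E @[n --> \oo] --> 0.
  under eq_fun do rewrite (lower_integral_setD mN N0)//.
  rewrite -/M.
  have <- : \int[mu]_(x in M) (cst 0 x) = 0 :> \bar R by exact: integral0.
  have mf n : measurable_fun M (fun x => `|u x - t n x|%:E).
    apply/measurable_EFinP.
    apply: (@measurable_norm_lim _ (fun m x => s m x - t n x)%R) => //.
      move=> m.
      exact: (simple_on_comp (fun p : E * E => p.1 - p.2)%R (simple_on_pair (ss m) (st n))).
    by move=> x Mx; apply: cvgB; [exact: sN|exact: cvg_cst].
  apply: (@dominated_cvg _ _ _ mu M mM _ _ (fun x => 3%:E * `|u x|%:E)) => //.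
  - move=> x Mx; apply: cvg_EFin; first exact: nearW.
    rewrite -(normr0 E); apply: cvg_norm; rewrite -(subrr (u x)).
    by apply: cvgB; [exact: cvg_cst|exact: tu].
  - apply/integrableP; split; first exact: measurable_funeM.
    rewrite (eq_integral (fun x => 3%:E * `|u x|%:E)); last first.
      by move=> x _; rewrite gee0_abs// mule_ge0.
    rewrite ge0_integralZl// lte_mul_pinfty//.
    by rewrite -(lower_integral_setD mN N0).
  - move=> n x Mx; rewrite gee0_abs// -EFinM lee_fin (le_trans (ler_normB _ _))//.
    by have := t_le n x; lra.
have dist_le n m : `|simple_integral mu D (t n) - simple_integral mu D (t m)|%:E <=
    \int[mu]_(x in D) `|u x - t n x|%:E + \int[mu]_(x in D) `|u x - t m x|%:E.
  have itN : integrable_simple mu D (-%R \o t m).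
    exact: integrable_simple_comp (oppr0 _) (it m).
  have [isB eB] := integrable_simpleD (it n) itN.
  rewrite -(simple_integral_linear -%R (it m)) -eB.
  apply: (le_trans (simple_integral_norm mD isB)).
  have mt k : almost_measurable mu D (fun x => `|u x - t k x|%:E).
    apply: strongly_measurable_norm; apply: strongly_measurableD.
      exists s; split => //; exists N; split => // x /= H; apply: contrapT => Nx.
      by apply: H => Dx; apply: sN.
    exact/strongly_measurableN/simple_on_strongly_measurable.
  rewrite -lower_integralD//; apply: lower_integral_le => // x _.
  rewrite -EFinD lee_fin [leRHS]addrC; apply: le_trans (ler_normB _ _).
  by rewrite opprB [in leRHS]addrC addrA subrK.
suff cz : cvg (simple_integral mu D (t n) @[n --> \oo]).
  exists (lim (simple_integral mu D (t n) @[n --> \oo])), t; split => //.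
    by move=> n; exact: (it n).2.
  exists N; split => // x /= H; apply: contrapT => Nx.
  by apply: H => Dx; apply: tu.
apply/cauchy_cvgP; apply: cauchy_exP => e e0.
have e20 : (0 < e / 2)%R by rewrite divr_gt0.
have /fine_cvgP[fin_near fine_cvg0] := cvg_dist.
have : \forall n \near \oo, \int[mu]_(x in D) `|u x - t n x|%:E < (e / 2)%:E.
  move/cvgrPdist_lt : fine_cvg0 => /(_ _ e20); apply: filterS2 fin_near => n nfin.
  rewrite sub0r normrN -lte_fin /= ger0_norm ?fine_ge0 ?integral_ge0//.
  by rewrite fineK.
move=> [n0 _ n0P]; exists (simple_integral mu D (t n0)); exists n0 => // n nn0.
rewrite -ball_normE/= -lte_fin (le_lt_trans (dist_le _ _))//.
by rewrite [e in (e%:E)]splitr EFinD lteD// n0P//=.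
Unshelve. all: by end_near. Qed.

End bochner_integral.

(** * Decreasing absolutely continuous functions are integrals *)

Section absolutely_continuous_stieltjes.
Context (R : realType).
Implicit Types (F : cumulative R R) (x y : R).

Lemma stieltjes_measure_oc F x y : x <= y ->
  lebesgue_stieltjes_measure F `]x, y]%classic = (F y - F x)%:E.
Proof.
move=> xy; rewrite /lebesgue_stieltjes_measure /measure_extension.
by rewrite measurable_mu_extE/= ?wlength_itv_bnd//; exact: is_ocitv.
Qed.

(** Cutting ]x, y] into finer and finer cells of equal length, every point of
    the open set U ends up in a cell contained in U; the cells inside U form a
    finite disjoint family to which absolute continuity applies. *)
Lemma stieltjes_measure_open_le F x y (e d : R) (U : set R) : x < y ->
  (forall (n : nat) (l r : 'I_n -> R),
     (forall i, x <= l i /\ l i <= r i /\ r i <= y) ->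
     trivIset setT (fun i => `]l i, r i[%classic) ->
     \sum_(i < n) (r i - l i) < d -> \sum_(i < n) `|F (r i) - F (l i)| < e) ->
  open U -> (lebesgue_measure U < d%:E)%E ->
  (lebesgue_stieltjes_measure F (U `&` `]x, y]) <= e%:E)%E.
Proof.
move=> xy acF oU Ud.
have mU : measurable U by exact: open_measurable.
pose w n : R := (y - x) / n.+1%:R.
have w0 n : 0 < w n by rewrite divr_gt0// subr_gt0.
pose r n (i : nat) : R := y - i%:R * w n.
have rS n i : r n i.+1 = r n i - w n.
  by rewrite /r -natr1 mulrDl mul1r opprD addrA.
pose good n i : bool := `[< `]r n i.+1, r n i] `<=` U >].
(* a cell that leaves U is replaced by an empty one *)
pose l n i := if good n i then r n i.+1 else r n i.
have lr n i : l n i <= r n i by rewrite /l; case: ifP => // _; rewrite rS gerBl ltW.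
have rl n i : r n i.+1 <= l n i by rewrite /l; case: ifP => // _; rewrite rS gerBl ltW.
pose V n := \big[setU/set0]_(i < n.+1) `]l n i, r n i]%classic.
have mI n (i : 'I_n.+1) : measurable (`]l n i, r n i]%classic : set (measurableTypeR R)).
  exact: measurable_itv.
have mV n : measurable (V n) by exact: bigsetU_measurable.
have r_noninc n i j : (i <= j)%N -> r n j <= r n i.
  by move=> ij; rewrite /r lerB// ler_wpM2r ?ler_nat// ltW.
have tV n : trivIset setT (fun i : 'I_n.+1 => `]l n i, r n i]%classic).
  suff tN : trivIset setT (fun i : nat => `]l n i, r n i]%classic).
    by move=> i j _ _ /(tN i j I I) /val_inj.
  apply: ltn_trivIset => j i ji; apply/seteqP; split => // z [/=].
  rewrite !in_itv/= => /andP[iz _] /andP[_ zj].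
  have := le_lt_trans (rl n i) iz; rewrite ltNge => /negP; apply.
  by rewrite (le_trans zj)// r_noninc.
have VU n : V n `<=` U.
  apply: (big_ind (fun A => A `<=` U)) => [//|A B AU BU z [/AU|/BU]//|].
  move=> i _; rewrite /l; case: ifPn => [/asboolP//|_ z /=].
  by rewrite in_itv/= => /andP[/lt_le_trans/[apply]]; rewrite ltxx.
have V_le n : (lebesgue_stieltjes_measure F (V n) <= e%:E)%E.
  rewrite measure_bigsetU_ord; [|exact: mI|exact: tV].
  have -> : (\sum_(i < n.+1) lebesgue_stieltjes_measure F `]l n i, r n i]%classic)%E =
      (\sum_(i < n.+1) `|F (r n i) - F (l n i)|)%:E.
    rewrite -sumEFin; apply: eq_bigr => i _; rewrite stieltjes_measure_oc//.
    by rewrite ger0_norm// subr_ge0 (cumulative_is_nondecreasing F).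
  rewrite lee_fin ltW// acF//.
  - move=> i; split.
      rewrite (le_trans _ (rl n i))// /r lerBrDr -lerBrDl.
      rewrite /w mulrCA ler_piMr ?subr_ge0 ?(ltW xy)//.
      by rewrite ler_pdivrMr// mul1r ler_nat.
    by split => //; rewrite /r gerBl mulr_ge0// ltW.
  - move=> i j _ _ [z [/= zi zj]]; apply: (tV n) => //.
    by exists z; split => /=; exact: subset_itv_oo_oc.
  - rewrite -lte_fin; apply: le_lt_trans Ud.
    have -> : (\sum_(i < n.+1) (r n i - l n i))%:E = lebesgue_measure (V n).
      rewrite measure_bigsetU_ord; [|exact: mI|exact: tV].
      rewrite -sumEFin; apply: eq_bigr => i _.
      by rewrite [RHS](stieltjes_measure_oc idfun).
    apply: le_measure; [exact: (mem_set (mV n))|exact: (mem_set mU)|exact: VU].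
(* the cells of different scales are not nested, hence the intersections *)
pose W m := \bigcap_(n in [set n | (m <= n)%N]) V n.
have mW m : measurable (W m).
  by apply: bigcap_measurable => [|n _]; [exists m => /=|exact: mV].
have WW : nondecreasing_seq W.
  move=> m k mk; apply/subsetPset => z Wz n /= kn; apply: Wz => /=.
  exact: leq_trans kn.
have UW : U `&` `]x, y] `<=` \bigcup_m W m.
  move=> z [Uz]; rewrite /= in_itv/= => /andP[xz zy].
  have [/= rho rho0 rhoU] : nbhs_ball z U by apply/nbhs_ballP; exact: oU.
  have : \forall m \near \oo, w m < rho.
    near=> m; rewrite /w ltr_pdivrMr// -ltr_pdivrMl//.
    apply: (@lt_trans _ _ m%:R); last by rewrite ltr_nat.
    near: m; exact: nbhs_infty_gtr.
  move=> [m _ wm]; exists m => // n /= mn.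
  have wn := wm n mn; pose q := (y - z) / w n.
  have q0 : 0 <= q by rewrite divr_ge0 ?subr_ge0 ?(ltW (w0 n)).
  have /andP[iq qi] := truncn_itv q0.
  have zi : z <= r n (Num.truncn q) by rewrite /r lerBrDl -lerBrDr -ler_pdivlMr.
  have iz : r n (Num.truncn q).+1 < z by rewrite /r ltrBlDl -ltrBlDr -ltr_pdivrMr.
  have qn : (Num.truncn q < n.+1)%N.
    rewrite -(ltr_nat R) (le_lt_trans iq)// ltr_pdivrMr//.
    by rewrite /w mulrC divfK// ltrD2l ltrN2.
  have gq : good n (Num.truncn q).
    apply/asboolP => v /=; rewrite in_itv/= => /andP[iv vi]; apply: rhoU.
    rewrite /ball/= ltr_norml; move: iz zi iv vi; rewrite rS => *.
    by apply/andP; split; lra.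
  rewrite /V (bigD1 (Ordinal qn))//=; left => /=.
  by rewrite in_itv/= /l gq iz.
have mUxy : measurable (U `&` `]x, y]%classic).
  exact: measurableI.
have mWW : measurable (\bigcup_m W m) by exact: bigcup_measurable.
apply: (@le_trans _ _ (lebesgue_stieltjes_measure F (\bigcup_m W m))).
  by apply: le_measure; [exact: mem_set|exact: mem_set|].
have := @nondecreasing_cvg_mu _ (measurableTypeR R) R
  (lebesgue_stieltjes_measure F) W mW mWW WW.
move=> /cvg_lim <-//; apply: lime_le.
  apply: ereal_nondecreasing_is_cvgn => m k mk.
  apply: le_measure; [exact: (mem_set (mW m))|exact: (mem_set (mW k))|].
  by apply/subsetPset; exact: WW.
apply: nearW => m; have := V_le m; apply: le_trans.
apply: le_measure; [exact: (mem_set (mW m))|exact: (mem_set (mV m))|].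
by move=> z; apply => /=.
Unshelve. all: by end_near. Qed.

Lemma stieltjes_measure_null F x y (N : set R) : x < y ->
  abs_continuous_on x y F -> measurable N -> lebesgue_measure N = 0%E ->
  lebesgue_stieltjes_measure F (N `&` `]x, y]) = 0%E.
Proof.
move=> xy acF mN N0; apply/eqP; rewrite eq_le measure_ge0 andbT.
apply/lee_addgt0Pr => e e0; rewrite add0e.
have [d d0 acd] := acF _ e0.
have Nfin : (lebesgue_measure N < +oo)%E by rewrite N0.
have [U [oU NU UNd]] := lebesgue_regularity_outer mN Nfin d0.
have mU : measurable U by exact: open_measurable.
have mxy : measurable (`]x, y]%classic : set R) by exact: measurable_itv.
apply: (@le_trans _ _ (lebesgue_stieltjes_measure F (U `&` `]x, y]%classic))).
  apply: le_measure; [exact/mem_set/measurableI|exact/mem_set/measurableI|].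
  exact: setSI.
apply: (stieltjes_measure_open_le xy acd oU).
by rewrite -(setDUK NU) setUC measureU0//; exact: measurableD.
Qed.

Lemma abs_continuous_on_dist (f : R -> R) x y e : abs_continuous_on x y f ->
  0 < e -> exists2 d, 0 < d &
  forall u v, x <= u -> u <= v -> v <= y -> v - u < d -> `|f v - f u| < e.
Proof.
move=> acf /acf[d d0 fd]; exists d => // u v xu uv vy vud.
have := fd 1%N (fun=> u) (fun=> v); rewrite !big_ord1; apply => //.
by move=> i j _ _ _; rewrite !ord1.
Qed.

(** On a compact interval a non-increasing absolutely continuous function is
    the distribution function of a finite measure dominated by Lebesgue measure;
    its Radon-Nikodym density is minus the derivative by the Lebesgue
    differentiation theorem. *)
Lemma nonincreasing_abs_continuous_density (A : R -> R) x y : x < y ->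
  (forall u v, x <= u -> u <= v -> v <= y -> A v <= A u) ->
  abs_continuous_on x y A ->
  exists g : R -> R, [/\ measurable_fun setT g, forall z, 0 <= g z,
    forall u v, x <= u -> u <= v -> v <= y ->
      (\int[lebesgue_measure]_(z in `]u, v]) (g z)%:E)%E = (A u - A v)%:E &
    {ae lebesgue_measure, forall z, x < z < y ->
      derivable A z 1 /\ derive1 A z = - g z}].
Proof.
move=> xy niA acA.
pose clamp z := Num.max x (Num.min z y).
have clamp_ge z : x <= clamp z by rewrite /clamp le_max lexx.
have clamp_le z : clamp z <= y by rewrite /clamp ge_max (ltW xy) ge_min lexx orbT.
have clampE z : x <= z -> z <= y -> clamp z = z.
  by move=> xz zy; rewrite /clamp (min_idPl zy) (max_idPr xz).
have clamp_nd u v : u <= v -> clamp u <= clamp v /\ clamp v - clamp u <= v - u.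
  move=> uv; rewrite /clamp /Num.max /Num.min.
  by do ![case: ifPn; rewrite -?leNgt] => *; split; lra.
pose F0 z := - A (clamp z).
have F0nd : {homo F0 : u v / u <= v}.
  by move=> u v /clamp_nd[uv _]; rewrite lerN2 niA.
have F0rc : right_continuous F0.
  apply: right_continuousW => z; apply/cvgrPdist_lt => e e0.
  have [d d0 dA] := abs_continuous_on_dist acA e0.
  near=> v; rewrite /F0 opprK addrC.
  have vz : `|z - v| < d by near: v; have := nbhsx_ballx z d d0; rewrite -ball_normE.
  have [zv|vz'] := leP z v.
    have [] := clamp_nd _ _ zv => c1 c2.
    apply: dA => //.
    by rewrite (le_lt_trans c2)// (le_lt_trans _ vz)// distrC ler_norm.
  have [] := clamp_nd _ _ (ltW vz') => c1 c2.
  rewrite distrC; apply: dA => //.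
  by rewrite (le_lt_trans c2)// (le_lt_trans _ vz)// ler_norm.
pose F : cumulative R R := HB.pack F0 (isCumulative.Build R _ R F0 F0nd F0rc).
pose ls := lebesgue_stieltjes_measure F.
pose I : set (measurableTypeR R) := `]x, y]%classic.
have mI : measurable I by exact: measurable_itv.
have lsoc u v : u <= v -> ls `]u, v]%classic = (F0 v - F0 u)%:E.
  exact: stieltjes_measure_oc.
have I_fin : (ls I < +oo)%E by rewrite /I lsoc ?ltry// ltW.
have acF : abs_continuous_on x y F0.
  move=> e /acA[d d0 dA]; exists d => // n l r lr tlr lrd.
  rewrite (eq_bigr (fun i => `|A (r i) - A (l i)|)); first exact: dA.
  move=> i _; have [xl [lri ry]] := lr i.
  rewrite /F0 (clampE (r i)) ?(le_trans xl lri)// (clampE (l i)) ?(le_trans lri)//.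
  by rewrite opprK addrC distrC.
have dom : mfrestr mI I_fin `<< @lebesgue_measure R.
  apply/null_content_dominatesP => N mN N0.
  by have := @stieltjes_measure_null F x y N xy acF mN N0.
have [g [g0 gfin ig gE]] := radon_nikodym_sigma_finite dom.
pose h z := fine (g z).
have hE z : (h z)%:E = g z by rewrite /h fineK.
have mh : measurable_fun setT h.
  by apply/measurable_EFinP; rewrite (_ : _ \o _ = g);
    [case/integrableP : ig|exact/funext].
have int_h u v : x <= u -> u <= v -> v <= y ->
    (\int[lebesgue_measure]_(z in `]u, v]) (h z)%:E)%E = (A u - A v)%:E.
  move=> xu uv vy; under eq_integral do rewrite hE.
  rewrite -gE; last exact: measurable_itv.
  transitivity (ls (`]u, v]%classic `&` I)); first by [].
  rewrite setIidl; last first.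
    move=> z; rewrite /I /= !in_itv/= => /andP[uz zv].
    by rewrite (le_lt_trans xu)//= (le_trans zv).
  rewrite lsoc// /F0 (clampE v) ?(le_trans xu uv)// (clampE u) ?(le_trans uv)//.
  by rewrite opprK addrC.
exists h; split => //.
- by move=> z; rewrite fine_ge0.
have ih : lebesgue_measure.-integrable setT (EFin \o h).
  by rewrite (_ : _ \o _ = g)//; exact/funext.
have lh : locally_integrable setT h.
  by apply: open_integrable_locally => //; exact: openT.
have ih' z : lebesgue_measure.-integrable `]x, z] (EFin \o h).
  by apply: integrableS ih.
have := FTC1 ih' lh; apply: filterS.
  exact: (ae_filter_ringOfSetsType lebesgue_measure).
move=> z zP /andP[xz zy].
have {zP} [] := zP xz.
set G := (fun z => _) => dG <-.
have AG : {near z, (cst (A x) - G) =1 A}.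
  near=> v => /=; rewrite /cst !fctE /G /Rintegral.
  have xv : x < v by near: v; exact: lt_nbhsr.
  have vy : v < y by near: v; exact: lt_nbhsl.
  by rewrite int_h ?lexx ?(ltW xv) ?(ltW vy)//= opprB addrC subrK.
have dAG : derivable (cst (A x) - G) z 1 by exact: derivableB.
split; first exact: near_eq_derivable dAG.
rewrite derive1E -(near_eq_derive _ AG) deriveB//.
by rewrite derive_cst sub0r derive1E.
Unshelve. all: by end_near. Qed.

End absolutely_continuous_stieltjes.

Section density_half_line.
Context (R : realType).
Implicit Types (A : R -> R) (u v : R).

Lemma ae_lebesgue_imply (P Q : R -> Prop) : (forall z, P z -> Q z) ->
  {ae @lebesgue_measure R, forall z, P z} -> {ae @lebesgue_measure R, forall z, Q z}.
Proof.
move=> PQ [N [mN N0 PN]]; exists N; split => // z nQ.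
by apply: PN => /= /PQ.
Qed.

Lemma ae_lebesgue_imply2 (P Q S : R -> Prop) : (forall z, P z -> Q z -> S z) ->
  {ae @lebesgue_measure R, forall z, P z} -> {ae @lebesgue_measure R, forall z, Q z} ->
  {ae @lebesgue_measure R, forall z, S z}.
Proof.
move=> PQS [N [mN N0 PN]] [N' [mN' N'0 QN']].
exists (N `|` N'); split; [exact: measurableU|by rewrite measureU0|].
move=> z nS; have [Pz|/PN] := pselect (P z); last by left.
by right; apply: QN' => /= Qz; apply: nS; exact: PQS.
Qed.

Lemma locally_abs_continuous_continuous A : locally_abs_continuous A ->
  {in (pos_half_line : set R), continuous A}.
Proof.
move=> acA z /set_mem; rewrite /pos_half_line/= in_itv/= andbT => z0.
have z20 : 0 < z / 2 by rewrite divr_gt0.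
have [] : z / 2 < z /\ z < z + 1 by split; lra.
move=> zl zr; have zz : z / 2 <= z + 1 by rewrite ltW// (lt_trans zl).
apply/cvgrPdist_lt => e e0.
have [d d0 dA] := abs_continuous_on_dist (acA _ _ z20 zz) e0.
near=> v.
have vz : `|z - v| < d by near: v; have := nbhsx_ballx z d d0; rewrite -ball_normE.
have zv : z / 2 < v by near: v; exact: lt_nbhsr.
have vz1 : v < z + 1 by near: v; exact: lt_nbhsl.
have [lezv|ltvz] := leP z v.
  rewrite distrC; apply: dA; rewrite ?(ltW zl) ?(ltW vz1)//.
  by rewrite (le_lt_trans _ vz)// distrC ler_norm.
apply: dA; rewrite ?(ltW zr) ?(ltW zv) ?(ltW ltvz)//.
by rewrite (le_lt_trans _ vz)// ler_norm.
Unshelve. all: by end_near. Qed.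

(** The densities over the compact subintervals are glued by means of the upper
    limit of difference quotients, a measurable function defined everywhere. *)
Lemma nonincreasing_locally_abs_continuous_density A :
  (forall u v, 0 < u -> u <= v -> A v <= A u) -> locally_abs_continuous A ->
  exists h : R -> R, [/\ measurable_fun setT h, forall z, 0 <= h z,
    forall u v, 0 < u -> u <= v ->
      (\int[lebesgue_measure]_(z in `]u, v]) (h z)%:E)%E = (A u - A v)%:E &
    {ae lebesgue_measure, forall z, 0 < z -> h z = - derive1 A z}].
Proof.
move=> niA acA.
have local u v : 0 < u -> u < v -> exists g : R -> R,
    [/\ measurable_fun setT g, forall z, 0 <= g z,
    forall a b, u <= a -> a <= b -> b <= v ->
      (\int[lebesgue_measure]_(z in `]a, b]) (g z)%:E)%E = (A a - A b)%:E &
    {ae lebesgue_measure, forall z, u < z < v ->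
      derivable A z 1 /\ derive1 A z = - g z}].
  move=> u0 uv; apply: nonincreasing_abs_continuous_density => //.
    by move=> a b ua ab _; apply: niA => //; exact: lt_le_trans ua.
  by apply: acA => //; exact: ltW.
pose q n z := n.+1%:R * (A z - A (z + n.+1%:R^-1)).
pose h0 z := `|fine (limn_esup (fun n => (q n z)%:E))|.
pose h := h0 \_ pos_half_line.
have mD : measurable (pos_half_line : set R) by exact: measurable_itv.
have oD : open (pos_half_line : set R) by exact: interval_open.
have cA := locally_abs_continuous_continuous acA.
have mq n : measurable_fun pos_half_line (q n).
  apply: open_continuous_measurable_fun => // z zD.
  have z0 : 0 < z by move/set_mem: zD; rewrite /pos_half_line/= in_itv/= andbT.
  apply: cvgM; first exact: cvg_cst.
  apply: cvgB; first exact: cA.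
  apply: (@cvg_comp _ _ _ (fun z => z + n.+1%:R^-1) A _ (nbhs (z + n.+1%:R^-1))).
    by apply: cvgD; [exact: cvg_id|exact: cvg_cst].
  apply: cA; apply/mem_set; rewrite /pos_half_line/= in_itv/= andbT.
  by rewrite addr_gt0// invr_gt0.
have mh : measurable_fun setT h.
  apply/(measurable_restrictT _ _).1 => //; apply: measurableT_comp => //.
  apply: measurableT_comp => //.
  by apply: measurable_fun_limn_esup => n; apply/measurable_EFinP.
have derivE z : 0 < z -> derivable A z 1 -> h z = `|derive1 A z|.
  move=> z0 dA; rewrite /h patchE mem_set/=; last by rewrite /pos_half_line/= in_itv/= z0.
  have qz : q n z @[n --> \oo] --> - derive1 A z.
    have dcvg : h^-1 *: (A (h *: 1 + z) - A z) @[h --> 0^'] --> derive1 A z.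
      by rewrite derive1E; exact: dA.
    move/cvgr_dnbhsP : dcvg => /(_ (fun n => n.+1%:R^-1)) dcvg.
    have -> : q ^~ z = (fun n => - (n.+1%:R^-1^-1 *:
        (A (n.+1%:R^-1 *: 1 + z) - A z))).
      apply/funext => n; rewrite /q invrK /GRing.scale/= mulr1 -mulrN opprB.
      by rewrite [z + _]addrC.
    apply: cvgN; apply: dcvg; split => [n|]; first by rewrite invr_eq0.
    exact: cvg_harmonic.
  have qzE : (q n z)%:E @[n --> \oo] --> (- derive1 A z)%:E.
    by apply: cvg_EFin => //; exact: nearW.
  by rewrite /h0 (cvg_limn_einf_sup qzE).2 /= normrN.
have ae_deriv : {ae lebesgue_measure, forall z : R, 0 < z ->
    derivable A z 1 /\ derive1 A z <= 0}.
  have Hn (n : nat) : {ae lebesgue_measure, forall z : R,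
      n.+2%:R^-1 < z < n.+2%:R -> derivable A z 1 /\ derive1 A z <= 0}.
    have n1 : 1 < n.+2%:R :> R by rewrite ltr1n.
    have n0 : 0 < n.+2%:R^-1 :> R by rewrite invr_gt0 ltr0n.
    have nn : n.+2%:R^-1 < n.+2%:R :> R.
      by rewrite (lt_trans _ n1)// invf_lt1.
    have [g [_ g0 _]] := local _ _ n0 nn.
    by apply: ae_lebesgue_imply => z H /H[dA ->]; split => //; rewrite oppr_le0.
  have := ae_foralln Hn; apply: ae_lebesgue_imply => z H z0.
  have [n zn] : exists n : nat, Num.max z z^-1 < n.+2%:R.
    exists (Num.truncn (Num.max z z^-1)); rewrite (lt_trans (truncnS_gt _))//.
    by rewrite ltr_nat.
  move: zn; rewrite gt_max => /andP[zn zn']; apply: (H n); rewrite zn andbT.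
  by rewrite invf_plt// posrE ltr0n.
exists h; split => //.
- by move=> z; rewrite /h patchE; case: ifP => // _; rewrite /h0.
- move=> u v u0 uv.
  have u20 : 0 < u / 2 by rewrite divr_gt0.
  have [] : u / 2 < u /\ v < v + 1 by split; lra.
  move=> ul vr; have uv' : u / 2 < v + 1.
    by rewrite (lt_trans ul)// (le_lt_trans uv).
  have [g [mg g0 gI gE]] := local _ _ u20 uv'.
  rewrite -gI ?(ltW ul) ?(ltW vr)//.
  apply: lower_integral_ae_eq => //.
  + by move=> z _; rewrite lee_fin /h patchE; case: ifP => // _; rewrite /h0.
  + by move=> z _; rewrite lee_fin.
  move: gE; apply: ae_lebesgue_imply => z gE /=; rewrite in_itv/= => /andP[uz zv].
  have [|dA dE] := gE; first by rewrite (lt_trans ul)//= (le_lt_trans zv).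
  by rewrite derivE ?(lt_trans u0)// dE normrN ger0_norm.
- move: ae_deriv; apply: ae_lebesgue_imply => z H z0; have [dA dA0] := H z0.
  by rewrite derivE// ler0_norm.
Qed.

End density_half_line.

(** * Slowly varying weights *)

Lemma sum_half_powers (R : realType) n :
  \sum_(0 <= k < n) 2^-1 ^+ k <= 2 :> R.
Proof.
suff -> : \sum_(0 <= k < n) 2^-1 ^+ k = 2 - 2 * 2^-1 ^+ n :> R.
  by rewrite gerBl mulr_ge0// exprn_ge0.
elim: n => [|n IHn]; first by rewrite big_nil expr0 mulr1 subrr.
by rewrite big_nat_recr//= IHn exprS mulrA mulfV// mul1r mulr_natl mulr2n; ring.
Qed.

Lemma nneseries_le (R : realType) (f : nat -> \bar R) (M : \bar R) :
  (forall k, 0 <= f k)%E -> (forall n, \sum_(0 <= k < n) f k <= M)%E ->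
  (\sum_(k <oo) f k <= M)%E.
Proof.
move=> f0 fM; apply: lime_le; last exact: nearW.
by apply: is_cvg_nneseries => n _ _.
Qed.

Section decreasing_weight.
Context (R : realType).
Implicit Types (A b h : R -> R) (u v s t : R).

Lemma slowly_varying_almost_increasing b e : slowly_varying b -> 0 < e ->
  exists2 M : R, 0 < M &
  forall u v, 0 < u -> u <= v -> u `^ e * b u <= M * (v `^ e * b v).
Proof.
move=> [_ _ sv] e0; have [[g [g0 gnd [c1 [c2 [c10 c20 bg]]]]] _] := sv _ e0.
exists (c1 * c2); first exact: mulr_gt0.
move=> u v u0 uv; have v0 : 0 < v by exact: lt_le_trans uv.
have [bgu _] := bg _ u0; have [_ gbv] := bg _ v0.
have guv : g u <= g v.
  by apply: gnd => //; apply/mem_set; rewrite /pos_half_line/= in_itv/= andbT.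
rewrite (le_trans bgu)// -mulrA ler_pM2l// (le_trans guv)//.
Qed.

Lemma integral_bigcup_le (F : nat -> set R) (f : R -> \bar R) (M : \bar R) :
  (forall k, measurable (F k)) -> measurable_fun setT f -> (forall x, 0 <= f x)%E ->
  trivIset setT F ->
  (forall n, \sum_(0 <= k < n) \int[lebesgue_measure]_(x in F k) f x <= M)%E ->
  (\int[lebesgue_measure]_(x in \bigcup_k F k) f x <= M)%E.
Proof.
move=> mF mf f0 tF FM; rewrite ge0_integral_bigcup//; last first.
  by apply: measurable_funTS.
by apply: nneseries_le => // k; exact: integral_ge0.
Qed.

Lemma trivIset_nonincreasing_cells (s : nat -> R) :
  (forall k, s k.+1 <= s k) -> trivIset setT (fun k => `]s k.+1, s k]%classic).
Proof.
move=> sS; have snd i j : (i <= j)%N -> s j <= s i.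
  exact: (nonincreasing_seqP s).1.
apply: ltn_trivIset => j i ij; apply/seteqP; split => // z [/=].
rewrite !in_itv/= => /andP[iz _] /andP[_ zj].
by have := lt_le_trans iz (le_trans zj (snd _ _ ij)); rewrite ltxx.
Qed.

Lemma trivIset_nondecreasing_cells (s : nat -> R) :
  (forall k, s k <= s k.+1) -> trivIset setT (fun k => `]s k, s k.+1]%classic).
Proof.
move=> sS; have snd i j : (i <= j)%N -> s i <= s j.
  exact: (nondecreasing_seqP s).1.
apply: ltn_trivIset => j i ij; apply/seteqP; split => // z [/=].
rewrite !in_itv/= => /andP[_ zi] /andP[jz _].
by have := lt_le_trans jz (le_trans zi (snd _ _ ij)); rewrite ltxx.
Qed.

Variable A : R -> R.
Hypothesis A_dec : forall u v, 0 < u -> u < v -> A v < A u.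
Hypothesis A_continuous : {in (pos_half_line : set R), continuous A}.
Hypothesis A_at_0 : A x @[x --> 0^'+] --> +oo.
Hypothesis A_at_oo : A x @[x --> +oo] --> (0 : R).

Lemma weight_nonincreasing u v : 0 < u -> u <= v -> A v <= A u.
Proof.
by move=> u0; rewrite le_eqVlt => /predU1P[->//|/(A_dec u0)/ltW].
Qed.

Lemma weight_gt0 u : 0 < u -> 0 < A u.
Proof.
move=> u0; apply: (@le_lt_trans _ _ (A (u + 1))); last by apply: A_dec; rewrite ?ltrDl.
rewrite -(cvg_lim _ A_at_oo)//; apply: limr_le; first by apply/cvg_ex; exists 0.
near=> x; apply: weight_nonincreasing; first by rewrite addr_gt0.
by near: x; apply: nbhs_pinfty_ge; exact: num_real.
Unshelve. all: by end_near. Qed.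

Lemma weight_lt u v : 0 < u -> 0 < v -> (A u < A v) = (v < u).
Proof.
move=> u0 v0; apply/idP/idP; last exact: A_dec.
by rewrite !ltNge; apply: contra; exact: weight_nonincreasing.
Qed.

Lemma weight_surjective y : 0 < y -> exists2 x, 0 < x & A x = y.
Proof.
move=> y0.
have [p p0 py] : exists2 p, 0 < p & y <= A p.
  have /cvgryPge/(_ y) := A_at_0 => yA.
  have : \forall p \near 0^'+, 0 < p /\ y <= A p.
    by near=> p; split; near: p; [exact: nbhs_right_gt|exact: yA].
  by move=> /filter_ex[p [p0 yp]]; exists p.
have [q pq qy] : exists2 q, p <= q & A q <= y.
  have : \forall q \near +oo, p <= q /\ A q <= y.
    near=> q; split; near: q; first by apply: nbhs_pinfty_ge; exact: num_real.
    by apply: (cvgr_le 0).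
  by move=> /filter_ex[q [pq qy]]; exists q.
have cA : {within `[p, q], continuous A}.
  apply: continuous_in_subspaceT => z /set_mem/=; rewrite in_itv/= => /andP[pz _].
  apply: A_continuous; apply/mem_set; rewrite /pos_half_line/= in_itv/= andbT.
  exact: lt_le_trans pz.
have yA : Num.min (A p) (A q) <= y <= Num.max (A p) (A q).
  by rewrite ge_min le_max py qy orbT.
have [x] := IVT pq cA yA; rewrite in_itv/= => /andP[px _] Ax.
by exists x => //; exact: lt_le_trans px.
Unshelve. all: by end_near. Qed.

(** Cutting at the points where A doubles, and not at the points 2 ^- k, is what
    relates sums of values of a function to its integral against the density. *)
Lemma weight_levels s : 0 < s -> exists t : nat -> R, [/\ t 0%N = s,
  forall k, 0 < t k, forall k, A (t k) = 2 ^+ k * A s,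
  forall k, t k.+1 < t k &
  forall z, 0 < z -> z <= s -> exists k, t k.+1 < z <= t k].
Proof.
move=> s0; have A0 := weight_gt0 s0.
have /choice[lev levP] y : exists x, 0 < y -> 0 < x /\ A x = y.
  have [/weight_surjective[x x0 xy]|_] := ltP 0 y; first by exists x.
  by exists 0.
have pk k : 0 < 2 ^+ k * A s by rewrite mulr_gt0// exprn_gt0.
have lev0 k := (levP _ (pk k)).1; have levA k := (levP _ (pk k)).2.
exists (fun k => lev (2 ^+ k * A s)); split => //.
- have := levA 0%N; rewrite expr0 mul1r => As; apply/eqP; rewrite eq_le !leNgt.
  have := lev0 0%N; rewrite expr0 mul1r => l0.
  by rewrite -(weight_lt l0 s0) -(weight_lt s0 l0) As ltxx.
- by move=> k; rewrite -weight_lt// !levA exprS -mulrA ltr_pMl// ltr1n.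
- move=> z z0 zs; have Asz := weight_nonincreasing z0 zs.
  have ex_k : exists k, A z < 2 ^+ k * A s.
    exists (Num.truncn (A z / A s)).+1; rewrite -ltr_pdivrMr//.
    rewrite (lt_trans (truncnS_gt _))// -natrX ltr_nat.
    exact: ltn_expl.
  have := ex_minnP ex_k => -[[|k] kP kmin].
    by move: kP; rewrite expr0 mul1r ltNge Asz.
  exists k; rewrite -weight_lt// levA kP/= leNgt -weight_lt// levA -leNgt.
  by rewrite leNgt; apply/negP => /kmin; rewrite ltnn.
Qed.

Variable h : R -> R.
Hypothesis h_measurable : measurable_fun setT h.
Hypothesis h_ge0 : forall z, 0 <= h z.
Hypothesis h_integral : forall u v, 0 < u -> u <= v ->
  (\int[lebesgue_measure]_(z in `]u, v]) (h z)%:E)%E = (A u - A v)%:E.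

Lemma density_tail_le s : 0 < s ->
  (\int[lebesgue_measure]_(z in `]s, +oo[) (h z)%:E <= (A s)%:E)%E.
Proof.
move=> s0; pose r (k : nat) : R := s + k%:R.
have r0 k : 0 < r k by rewrite ltr_wpDr.
have rS k : r k <= r k.+1 by rewrite lerD2l ler_nat.
have -> : `]s, +oo[%classic = \bigcup_k `]r k, r k.+1]%classic.
  apply/seteqP; split => z /=; rewrite in_itv/= ?andbT.
    move=> sz; have ex_k : exists k, z <= r k.+1.
      exists (Num.truncn (z - s)); rewrite /r -lerBlDl ltW//.
      exact: truncnS_gt.
    have := ex_minnP ex_k => -[k zk kmin]; exists k => //=.
    rewrite in_itv/= zk andbT; case: k kmin {zk} => [_|k kmin].
      by rewrite /r addr0.
    by rewrite ltNge; apply/negP => /kmin; rewrite ltnn.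
  move=> [k _ /=]; rewrite in_itv/= => /andP[+ _]; apply: le_lt_trans.
  by rewrite lerDl.
apply: integral_bigcup_le => //.
- exact/measurable_EFinP.
- exact: trivIset_nondecreasing_cells.
move=> n; under eq_bigr do rewrite h_integral//.
rewrite sumEFin lee_fin (eq_bigr (fun k => - (A (r k.+1) - A (r k)))); last first.
  by move=> k _; rewrite opprB.
rewrite sumrN telescope_sumr// opprB {1}/r addr0 gerBl.
exact/ltW/weight_gt0/r0.
Qed.

(** This is where slow variation enters. With the exponent 1 / 2 it says that the
    points t k at which A has doubled k times satisfy t k <= M ^ 2 * s / 4 ^ k,
    so that the growth of A is absorbed by the factor z. *)
Lemma density_head_le M s : 0 < s -> 0 < M ->
  (forall u v, 0 < u -> u <= v -> u `^ 2^-1 * A u <= M * (v `^ 2^-1 * A v)) ->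
  (\int[lebesgue_measure]_(z in `]0%R, s]) (z * h z)%:E <=
   (2 * M ^+ 2 * (s * A s))%:E)%E.
Proof.
move=> s0 M0 svA; have [t [t0s t0 tA tS tz]] := weight_levels s0.
have As := weight_gt0 s0.
have ts k : t k <= s.
  by rewrite -t0s; apply: (nonincreasing_seqP t).1 => // i; exact/ltW.
have tk_le k : t k * 4 ^+ k <= M ^+ 2 * s.
  have := svA _ _ (t0 k) (ts k); rewrite tA !mulrA ler_pM2r//.
  rewrite !powR12_sqrt; [|exact: ltW|exact: ltW]; move=> tsM.
  rewrite -(sqr_sqrtr (ltW (t0 k))) -(sqr_sqrtr (ltW s0)).
  have -> : 4 ^+ k = (2 ^+ k) ^+ 2 :> R.
    by rewrite -exprM mulnC exprM; congr (_ ^+ k); ring.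
  by rewrite -!exprMn ler_sqr// nnegrE mulr_ge0// ?exprn_ge0// ltW.
pose F k : set R := `]t k.+1, t k]%classic.
pose f z : \bar R := (Num.max z 0 * h z)%:E.
have f0 z : (0 <= f z)%E by rewrite lee_fin mulr_ge0// le_max lexx orbT.
have mf : measurable_fun setT f.
  by apply/measurable_EFinP/measurable_funM => //; exact: measurable_maxr.
have -> : (\int[lebesgue_measure]_(z in `]0%R, s]) (z * h z)%:E =
    \int[lebesgue_measure]_(z in \bigcup_k F k) f z)%E.
  rewrite (_ : \bigcup_k F k = `]0, s]%classic).
    apply: eq_integral => z /set_mem; rewrite /= in_itv/= => /andP[z0 _].
    by rewrite /f (max_idPl (ltW z0)).
  apply/seteqP; split => z /=; rewrite in_itv/=.
    move=> [k _]; rewrite /F/= in_itv/= => /andP[tz' zt].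
    by rewrite (lt_trans _ tz')//= (le_trans zt).
  by move=> /andP[z0 zs]; have [k kz] := tz _ z0 zs; exists k => //; rewrite /F/= in_itv.
apply: integral_bigcup_le => //.
- by move=> k; exact: measurable_itv.
- by apply: trivIset_nonincreasing_cells => k; exact/ltW.
move=> n.
have cell k : (\int[lebesgue_measure]_(x in F k) f x <=
    (M ^+ 2 * s * A s * 2^-1 ^+ k)%:E)%E.
  have Fk z : F k z -> f z = (z * h z)%:E.
    rewrite /F/= in_itv/= => /andP[tz' _].
    by rewrite /f (max_idPl _)// ltW// (lt_trans _ tz').
  apply: (@le_trans _ _ (\int[lebesgue_measure]_(z in F k) ((t k)%:E * (h z)%:E))%E).
    apply: lower_integral_le => [z _|z Fz]; first exact: f0.
    rewrite Fk// -EFinM lee_fin.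
    by rewrite ler_wpM2r//; move: Fz; rewrite /F/= in_itv/= => /andP[].
  rewrite ge0_integralZl; last 4 first.
  - exact: measurable_itv.
  - by apply/measurable_EFinP; exact: measurable_funTS.
  - by move=> z _; rewrite lee_fin.
  - by rewrite lee_fin ltW.
  rewrite (h_integral (t0 _) (ltW (tS _))) !tA -EFinM lee_fin exprS.
  rewrite (_ : _ - _ = 2 ^+ k * A s); last by ring.
  rewrite mulrA [leRHS]mulrAC ler_pM2r// exprVn ler_pdivlMr ?exprn_gt0//.
  by rewrite -mulrA -exprMn (_ : 2 * 2 = 4)//; ring.
apply: (@le_trans _ _ (\sum_(0 <= k < n) (M ^+ 2 * s * A s * 2^-1 ^+ k)%:E)%E).
  exact: lee_sum.
rewrite sumEFin lee_fin -mulr_sumr.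
rewrite (_ : 2 * _ * _ = M ^+ 2 * s * A s * 2); last by ring.
rewrite ler_pM2l ?mulr_gt0 ?exprn_gt0//.
exact: sum_half_powers.
Qed.

(** Up to the factor max(p, s * q), the kernel is at most 1 beyond s, where h has
    mass at most A s, and at most z / s before s. *)
Lemma density_kernel_le M s p q : 0 < s -> 0 < M ->
  (forall u v, 0 < u -> u <= v -> u `^ 2^-1 * A u <= M * (v `^ 2^-1 * A v)) ->
  0 <= p -> 0 <= q ->
  (\int[lebesgue_measure]_(z in pos_half_line) (h z * Num.min p (z * q))%:E <=
   ((1 + 2 * M ^+ 2) * (A s * Num.max p (s * q)))%:E)%E.
Proof.
move=> s0 M0 svA p0 q0; set J := Num.max p (s * q).
have J0 : 0 <= J by rewrite /J le_max p0.
have -> : (pos_half_line : set R) = `]0, s] `|` `]s, +oo[.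
  by rewrite /pos_half_line -itv_bndbnd_setU// bnd_simp// ltW.
have mf : measurable_fun setT (fun z => (h z * Num.min p (z * q))%:E).
  apply/measurable_EFinP/measurable_funM => //; apply: measurable_minr => //.
  exact: measurable_funM.
have f0 z : 0 < z -> (0 <= (h z * Num.min p (z * q))%:E)%E.
  by move=> z0; rewrite lee_fin mulr_ge0// le_min p0 mulr_ge0// ltW.
rewrite ge0_integral_setU//; last 3 first.
- exact: measurable_funTS.
- move=> z [|]/=; rewrite in_itv/= => /andP[z0 _]; apply: f0 => //.
  exact: lt_trans z0.
- rewrite disj_set2E; apply/eqP/seteqP; split => // z [/=].
  rewrite !in_itv/= andbT => /andP[_ zs] /(le_lt_trans zs).
  by rewrite ltxx.
rewrite mulrDl mul1r EFinD addeC; apply: leeD.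
  apply: (@le_trans _ _ (\int[lebesgue_measure]_(z in `]s, +oo[) (J%:E * (h z)%:E))%E).
    apply: lower_integral_le => z /=; rewrite in_itv/= andbT => sz.
      exact/f0/(lt_trans s0).
    by rewrite -EFinM lee_fin mulrC ler_wpM2r// ge_min le_max lexx.
  rewrite ge0_integralZl; last 4 first.
  - exact: measurable_itv.
  - by apply/measurable_EFinP; exact: measurable_funTS.
  - by move=> z _; rewrite lee_fin.
  - by rewrite lee_fin.
  by rewrite [in leRHS]mulrC EFinM lee_wpmul2l// density_tail_le.
apply: (@le_trans _ _ (\int[lebesgue_measure]_(z in `]0%R, s]) ((J / s)%:E * (z * h z)%:E))%E).
  apply: lower_integral_le => z /=; rewrite in_itv/= => /andP[z0 zs].
    exact: f0.
  rewrite -EFinM lee_fin [leRHS]mulrA [leRHS]mulrC ler_wpM2l// ge_min.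
  apply/orP; right; rewrite mulrC ler_wpM2r ?(ltW z0)//.
  by rewrite ler_pdivlMr// mulrC /J le_max lexx orbT.
rewrite ge0_integralZl; last 4 first.
- exact: measurable_itv.
- apply/measurable_EFinP; apply: measurable_funM => //; exact: measurable_funTS.
- by move=> z /=; rewrite in_itv/= => /andP[z0 _]; rewrite lee_fin mulr_ge0// ltW.
- by rewrite lee_fin divr_ge0// ltW.
apply: (@le_trans _ _ ((J / s)%:E * (2 * M ^+ 2 * (s * A s))%:E)%E).
  by apply: lee_wpmul2l; [rewrite lee_fin divr_ge0// ltW|exact: density_head_le].
rewrite -EFinM lee_fin le_eqVlt; apply/orP; left; apply/eqP.
by field; rewrite gt_eqF.
Qed.

End decreasing_weight.

(** * Strongly measurable functions with values in the intersection *)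

Section lower_integral_scale.
Local Open Scope ereal_scope.
Context d (T : measurableType d) (R : realType).
Variables (mu : {measure set T -> \bar R}) (D : set T).

Import HBNNSimple.

Lemma lower_integralZ_le (f : T -> \bar R) (r : R) : (0 < r)%R ->
  (forall x, D x -> 0 <= f x) ->
  \int[mu]_(x in D) (r%:E * f x) <= r%:E * \int[mu]_(x in D) f x.
Proof.
move=> r0 f0; rewrite [leLHS]ge0_integralE; last first.
  by move=> x Dx; rewrite mule_ge0 ?f0// lee_fin ltW.
apply: ge_ereal_sup => _ [k /= kf <-]; rewrite -integralT_nnsfun.
have mk : measurable_fun setT (fun x => (k x)%:E).
  by apply/measurable_EFinP; exact: measurable_funPT.
have -> : \int[mu]_x (k x)%:E = r%:E * \int[mu]_x (r^-1%:E * (k x)%:E).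
  rewrite ge0_integralZl//.
  - by rewrite muleA -EFinM mulfV ?mul1e// gt_eqF.
  - by move=> x _; rewrite lee_fin fun_ge0.
  - by rewrite lee_fin invr_ge0 ltW.
rewrite lee_pmul2l// [leRHS]integral_mkcond; apply: lower_integral_le => x _.
  by rewrite mule_ge0 ?lee_fin ?invr_ge0 ?fun_ge0// ltW.
have := kf x; rewrite /patch; case: ifPn => xD kx.
  by rewrite -(@lee_pmul2l _ r%:E) ?lte_fin// -!EFinM mulrA mulfV ?mul1r ?gt_eqF.
by apply: mule_ge0_le0; rewrite // lee_fin invr_ge0 ltW.
Qed.

End lower_integral_scale.

(** Iterated integrals need jointly measurable integrands, hence a version that
    is a limit of simple functions everywhere. *)
Lemma strongly_measurable_version d (T : measurableType d) (R : realType)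
    (mu : {measure set T -> \bar R}) (D : set T) (E : normedModType R) (u : T -> E) :
  measurable D -> strongly_measurable mu D u ->
  exists u' : T -> E, [/\ strongly_measurable mu D u',
    {ae mu, forall x, D x -> u' x = u x} &
    forall (F : normedModType R) (phi : E -> F), continuous phi -> phi 0 = 0 ->
      measurable_fun setT (fun x => `|phi (u' x)|)].
Proof.
move=> mD [s [ss su]]; have [N [mN N0 sN]] := su.
pose M := D `\` N; have mM : measurable M by exact: measurableD.
have {sN} sM x : M x -> s n x @[n --> \oo] --> u x.
  move=> [Dx]; apply: contra_notP => xs.
  by apply: sN => /= H; apply: xs; exact: H.
pose u' x := if x \in M then u x else 0.
have u'u : {ae mu, forall x, D x -> u' x = u x}.
  exists N; split => // x /=; apply: contra_notP => Nx Dx.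
  by rewrite /u' mem_set.
exists u'; split => //.
  exists s; split => //; apply: filterS2 su u'u => x sx ux Dx.
  by rewrite ux//; exact: sx.
move=> F phi cphi phi0.
rewrite (_ : (fun _ => _) = (fun x => `|phi (u x)|) \_ M); last first.
  apply/funext => x; rewrite /u' /patch; case: ifPn => // _.
  by rewrite phi0 normr0.
apply/(measurable_restrictT _ _).1 => //.
apply: (@measurable_norm_lim _ _ _ _ mD _ (fun n => phi \o s n)).
- exact: subDsetl.
- by move=> n; exact: simple_on_comp.
- by move=> x Mx; apply: continuous_cvg; [exact: cphi|exact: sM].
Qed.

Lemma measurable_half_line (R : realType) :
  measurable (pos_half_line : set (measurableTypeR R)).
Proof. exact: measurable_itv. Qed.

Lemma mem_half_line (R : realType) (s : R) : pos_half_line s <-> 0 < s.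
Proof. by rewrite /pos_half_line/= in_itv/= andbT. Qed.

Lemma measurable_continuous_half_line (R : realType) (f : R -> R) :
  {in (pos_half_line : set R), continuous f} -> measurable_fun pos_half_line f.
Proof. by apply: open_continuous_measurable_fun; exact: interval_open. Qed.

Lemma measurable_inv_half_line (R : realType) :
  measurable_fun (pos_half_line : set R) (fun s => s^-1).
Proof.
apply: measurable_continuous_half_line => s /set_mem/mem_half_line s0.
by apply: cvgV; [rewrite gt_eqF|exact: cvg_id].
Qed.

Section first_component.
Context {R : realType} {V : topologicalLmodType R}.
Context {X0 X1 : completeNormedModType R} (C : compatible_couple V X0 X1).

Definition inter_fst (y : inter_space C) : X0 := (inter_val y).1.

Fact inter_fst_linear : linear inter_fst.
Proof. by move=> k x y; rewrite /inter_fst linearP. Qed.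

HB.instance Definition _ :=
  GRing.isLinear.Build R (inter_space C) X0 *:%R inter_fst inter_fst_linear.

Lemma inter_fst_norm y : `|inter_fst y| <= `|y|.
Proof. by rewrite /inter_fst inter_norm_val prod_normE le_max lexx. Qed.

Lemma inter_fst_continuous : continuous inter_fst.
Proof.
move=> y; apply: (@continuous_comp _ _ _ (@inter_val _ _ _ _ C) fst).
  exact: inter_val_continuous.
exact: cvg_fst.
Qed.

Fact fst_to_sum_subproof (x : X0) : emb0 C x \in sum_pred C.
Proof.
apply/asboolP; exists (x, 0).
by rewrite /decompositions /= linear0 addr0.
Qed.

Definition fst_to_sum (x : X0) : sum_space C := SumSpace (fst_to_sum_subproof x).

Fact fst_to_sum_linear : linear fst_to_sum.
Proof. by move=> k x y; apply: val_inj; rewrite /= linearP. Qed.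

HB.instance Definition _ :=
  GRing.isLinear.Build R X0 (sum_space C) *:%R fst_to_sum fst_to_sum_linear.

Lemma fst_to_sum_norm x : `|fst_to_sum x| <= `|x|.
Proof.
apply: ge_inf; first by exists 0 => _ [p _ <-]; rewrite addr_ge0.
exists (x, 0) => /=; last by rewrite normr0 addr0.
by rewrite /decompositions /= linear0 addr0.
Qed.

Lemma inter_to_sumE y : inter_to_sum y = fst_to_sum (inter_fst y).
Proof. exact: val_inj. Qed.

Local Notation bochner := (is_bochner_integral lebesgue_measure pos_half_line).

(** A representation of finite norm converges absolutely already in X0. By the two
    following lemmas, it may be treated as a Bochner integral in X0, and the
    couple enters the representation only through that space. *)
Lemma J_representation_of_bochner (u : R -> inter_space C) f0 :
  strongly_measurable lebesgue_measure pos_half_line u ->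
  bochner (fun s => s^-1 *: inter_fst (u s)) f0 ->
  J_representation (emb0 C f0) u.
Proof.
move=> su uf0; split => //; exists (fst_to_sum f0) => //.
have mD := @measurable_half_line R.
have := bochner_contraction fst_to_sum_norm uf0.
rewrite (_ : _ \o _ = (fun s => s^-1 *: inter_to_sum (u s)))//.
by apply/funext => s /=; rewrite linearZ inter_to_sumE.
Qed.

Lemma bochner_of_J_representation f (u : R -> inter_space C) :
  J_representation f u ->
  (\int[lebesgue_measure]_(s in pos_half_line) `|s^-1 *: inter_fst (u s)|%:E < +oo)%E ->
  exists2 f0, f = emb0 C f0 & bochner (fun s => s^-1 *: inter_fst (u s)) f0.
Proof.
move=> [su [z <- uz]] ufin.
have mD := @measurable_half_line R.
have sfu : strongly_measurable lebesgue_measure pos_half_line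
    (fun s => s^-1 *: inter_fst (u s)).
  apply: strongly_measurableZ => //; last first.
    exact: (strongly_measurable_comp inter_fst_continuous).
  exact: measurable_inv_half_line.
have [f0 uf0] := bochner_exists mD sfu ufin.
exists f0 => //.
have := bochner_contraction fst_to_sum_norm uf0.
rewrite (_ : _ \o _ = (fun s => s^-1 *: inter_to_sum (u s))); last first.
  by apply/funext => s /=; rewrite linearZ inter_to_sumE.
by move=> /(bochner_unique mD uz) ->.
Qed.

End first_component.

(** * The K-functional of X0 and the intersection *)

Section K_functional_inter.
Context {R : realType} {V : topologicalLmodType R}.
Context {X0 X1 : completeNormedModType R} (C : compatible_couple V X0 X1).
Implicit Types (y : inter_space C) (t : R).

Local Notation K f0 t := (K_functional (inter_couple C) (emb0 C f0) t).
Local Notation pi0 := (@inter_fst R V X0 X1 C).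

(** As the intersection lies in X0, a decomposition of f0 is determined by its part
    in the intersection, so that K is an infimum over the intersection. *)
Lemma K_inter_le f0 y t : 0 <= t -> K f0 t <= `|f0 - pi0 y| + t * `|y|.
Proof.
move=> t0; apply: ge_inf.
  by exists 0 => _ [p _ <-]; rewrite addr_ge0// mulr_ge0.
exists (f0 - pi0 y, y) => //.
by rewrite /decompositions/= /inter_emb linearB subrK.
Qed.

Lemma le_K_inter f0 t m : (forall y, m <= `|f0 - pi0 y| + t * `|y|) -> m <= K f0 t.
Proof.
move=> fm; apply: lb_le_inf.
  exists (`|f0| + t * `|0 : inter_space C|), (f0, 0) => //.
  by rewrite /decompositions/= linear0 addr0.
move=> _ [[g y] /= fgy <-]; suff -> : g = f0 - pi0 y by exact: fm.
apply: (emb0_inj (c := C)); apply/eqP; rewrite linearB eq_sym subr_eq.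
by apply/eqP; exact: fgy.
Qed.

Lemma K_inter_ge0 f0 t : 0 <= t -> 0 <= K f0 t.
Proof. by move=> t0; apply: le_K_inter => y; rewrite addr_ge0// mulr_ge0. Qed.

Lemma K_inter_nondecreasing f0 s t : 0 <= s -> s <= t -> K f0 s <= K f0 t.
Proof.
move=> s0 st; apply: le_K_inter => y; apply: (le_trans (K_inter_le f0 y s0)).
by rewrite lerD2l ler_wpM2r.
Qed.

Lemma min_norm_le_K_inter f0 t : 0 <= t -> Num.min 1 t * `|f0| <= K f0 t.
Proof.
move=> t0; apply: le_K_inter => y.
have : `|f0| <= `|f0 - pi0 y| + `|y|.
  rewrite -{1}(subrK (pi0 y) f0) (le_trans (ler_normD _ _))// lerD2l.
  exact: inter_fst_norm.
have m0 : 0 <= Num.min 1 t by rewrite le_min ler01.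
move=> /(ler_wpM2l m0)/le_trans; apply; rewrite mulrDr lerD//.
  by rewrite ler_piMl// ge_min lexx.
by rewrite ler_wpM2r// ge_min lexx orbT.
Qed.

Lemma K_inter_almost_optimal f0 t : 0 < t ->
  exists y, `|f0 - pi0 y| + t * `|y| <= 2 * K f0 t.
Proof.
move=> t0; have [->|f00] := eqVneq f0 0.
  exists 0; rewrite (_ : pi0 0 = 0) ?subrr ?normr0 ?mulr0 ?addr0; last exact: linear0.
  by rewrite mulr_ge0// K_inter_ge0// ltW.
have K0 : 0 < K f0 t.
  apply: lt_le_trans (min_norm_le_K_inter f0 (ltW t0)).
  by rewrite mulr_gt0 ?normr_gt0// lt_min ltr01.
apply: contrapT => /forallNP Hy.
suff : 2 * K f0 t <= K f0 t by rewrite ger_pMl// lt_geF// ltr1n.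
by apply: le_K_inter => y; rewrite ltW// ltNge; apply/negP; exact: Hy.
Qed.

Local Open Scope ereal_scope.
Local Notation D := pos_half_line.
Local Notation mu := lebesgue_measure.

(** The part of x lying where its X0 norm is at most t times its norm in the
    intersection is integrated in X0, the rest in the intersection. *)
Lemma K_inter_le_integral (x : R -> inter_space C) f0 t : (0 < t)%R ->
  strongly_measurable mu D x ->
  measurable_fun setT (fun s => `|pi0 (x s)|)%R ->
  measurable_fun setT (fun s => `|x s|)%R ->
  \int[mu]_(s in D) `|pi0 (x s)|%:E < +oo ->
  is_bochner_integral mu D (pi0 \o x) f0 ->
  (K f0 t)%:E <= \int[mu]_(s in D) (Num.min `|pi0 (x s)| (t * `|x s|))%:E.
Proof.
move=> t0 sx mp mq pfin xf0; have mD := @measurable_half_line R.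
pose E : set (measurableTypeR R) := [set s | `|pi0 (x s)| <= t * `|x s|]%R.
have mE : measurable E.
  rewrite -[E]setTI; apply: measurable_fun_le => //.
  exact: measurable_funM.
have sp : strongly_measurable mu D (pi0 \o x).
  exact: (strongly_measurable_comp (@inter_fst_continuous _ _ _ _ C)).
have s1 : strongly_measurable mu D (fun s => \1_E s *: pi0 (x s))%R.
  by apply: strongly_measurableZ => //; exact: measurable_indic.
have s2 : strongly_measurable mu D (fun s => \1_(~` E) s *: x s)%R.
  apply: strongly_measurableZ => //; apply: measurable_indic.
  exact: measurableC.
have p1 s : (`|\1_E s *: pi0 (x s)| + t * `|\1_(~` E) s *: x s| =
    Num.min `|pi0 (x s)| (t * `|x s|))%R.
  rewrite !indicE in_setC; case: (boolP (s \in E)) => /=.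
    by move=> /set_mem/= /min_idPl->; rewrite scale1r scale0r normr0 mulr0 addr0.
  rewrite notin_setE /E/= => /negP; rewrite -ltNge => /ltW/min_idPr->.
  by rewrite scale1r scale0r normr0 add0r.
have le1 s : (`|\1_E s *: pi0 (x s)| <= `|pi0 (x s)|)%R.
  apply: (@le_trans _ _ (Num.min `|pi0 (x s)| (t * `|x s|))%R).
    by rewrite -p1 lerDl mulr_ge0// ltW.
  by rewrite ge_min lexx.
have le2 s : (`|\1_(~` E) s *: x s| <= t^-1 * `|pi0 (x s)|)%R.
  rewrite -ler_pdivrMl ?invr_gt0// invrK.
  apply: (@le_trans _ _ (Num.min `|pi0 (x s)| (t * `|x s|))%R).
    by rewrite -p1 lerDr.
  by rewrite ge_min lexx.
have [g xg] : exists g, is_bochner_integral mu D (fun s => \1_E s *: pi0 (x s))%R g.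
  apply: bochner_exists => //; apply: le_lt_trans pfin.
  by apply: lower_integral_le => // s _; rewrite lee_fin.
have [y xy] : exists y, is_bochner_integral mu D (fun s => \1_(~` E) s *: x s)%R y.
  apply: bochner_exists => //.
  apply: (@le_lt_trans _ _ (\int[mu]_(s in D) (t^-1%:E * `|pi0 (x s)|%:E))).
    by apply: lower_integral_le => // s _; rewrite -EFinM lee_fin.
  apply: (le_lt_trans (lower_integralZ_le _ _ _)) => //; first by rewrite invr_gt0.
  by rewrite lte_mul_pinfty// lee_fin invr_ge0 ltW.
have f0E : f0 = (g + pi0 y)%R.
  apply: (bochner_unique mD xf0).
  have := bochnerD mD xg (bochner_contraction (@inter_fst_norm _ _ _ _ C) xy).
  rewrite (_ : (fun s => _) = pi0 \o x)//; apply/funext => s /=.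
  rewrite linearZ/= -scalerDl !indicE in_setC.
  by case: (s \in E); rewrite ?addr0 ?add0r scale1r.
have := K_inter_le f0 y (ltW t0); rewrite f0E addrK -f0E => Kgy.
apply: (@le_trans _ _ (`|g| + t * `|y|)%:E); first by rewrite lee_fin.
have -> : \int[mu]_(s in D) (Num.min `|pi0 (x s)| (t * `|x s|))%:E =
    \int[mu]_(s in D) `|\1_E s *: pi0 (x s)|%:E +
    t%:E * \int[mu]_(s in D) `|\1_(~` E) s *: x s|%:E.
  have mi2 : measurable_fun D (fun s => `|\1_(~` E) s *: x s|%:E).
    apply/measurable_EFinP; rewrite (_ : (fun s => _) =
        (fun s => \1_(~` E) s * `|x s|)%R); last first.
      by apply/funext => s; rewrite normrZ ger0_norm.
    apply: measurable_funM; last exact: measurable_funTS.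
    by apply: measurable_indic; exact: measurableC.
  rewrite -ge0_integralZl//; last by rewrite lee_fin ltW.
  rewrite -ge0_integralD//.
  - by apply: eq_integral => s _; rewrite -EFinM -EFinD p1.
  - apply/measurable_EFinP; rewrite (_ : (fun s => _) =
        (fun s => \1_E s * `|pi0 (x s)|)%R); last first.
      by apply/funext => s; rewrite normrZ ger0_norm.
    apply: measurable_funM; last exact: measurable_funTS.
    exact: measurable_indic.
  - by move=> s _; rewrite mule_ge0 ?lee_fin// ltW.
  - exact: measurable_funeM.
rewrite EFinD EFinM; apply: leeD; first exact: (bochner_norm_le mD xg).
by apply: lee_wpmul2l; [rewrite lee_fin ltW|exact: (bochner_norm_le mD xy)].
Qed.

End K_functional_inter.

Lemma bochner_ae_eq d (T : measurableType d) (R : realType)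
    (mu : {measure set T -> \bar R}) (D : set T) (E : normedModType R) (u v : T -> E) z :
  {ae mu, forall x, D x -> v x = u x} ->
  is_bochner_integral mu D u z -> is_bochner_integral mu D v z.
Proof.
move=> vu [s [ss fs su us sz]]; exists s; split => //.
  by apply: filterS2 su vu => x sx vx Dx; rewrite vx//; exact: sx.
rewrite (_ : (fun n => _) = (fun n => \int[mu]_(x in D) `|u x - s n x|%:E)%E)//.
apply/funext => n; apply: lower_integral_ae_eq => //.
by apply: filterS vu => x vx Dx; rewrite vx.
Qed.

Section tonelli.
Context {R : realType} {V : topologicalLmodType R}.
Context {X0 X1 : completeNormedModType R} (C : compatible_couple V X0 X1).
Local Open Scope ereal_scope.

Local Notation K f0 t := (K_functional (inter_couple C) (emb0 C f0) t).
Local Notation pi0 := (@inter_fst R V X0 X1 C).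
Local Notation D := pos_half_line.
Local Notation mu := lebesgue_measure.

(** Tonelli's theorem reduces the inclusion of a J-space into the K-space to an
    estimate of the kernel min(p, t * q) for each s separately. *)
Lemma integral_K_inter_le (h : R -> R) (x : R -> inter_space C) f0
    (W : R -> \bar R) (c : R) :
  measurable_fun setT h -> (forall t, 0 <= h t)%R ->
  strongly_measurable mu D x -> is_bochner_integral mu D (pi0 \o x) f0 ->
  \int[mu]_(s in D) `|pi0 (x s)|%:E < +oo ->
  (0 < c)%R -> (forall s, D s -> 0 <= W s) ->
  (forall s, D s -> \int[mu]_(t in D) (h t * Num.min `|pi0 (x s)| (t * `|x s|))%:E
     <= c%:E * W s) ->
  \int[mu]_(t in D) (h t * K f0 t)%:E <= c%:E * \int[mu]_(s in D) W s.
Proof.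
move=> mh h0 sx xf0 xfin c0 W0 hW; have mD := @measurable_half_line R.
have [x' [sx' xx' mx']] := strongly_measurable_version mD sx.
have mp : measurable_fun setT (fun s => `|pi0 (x' s)|)%R.
  by apply: mx'; [exact: inter_fst_continuous|exact: linear0].
have mq : measurable_fun setT (fun s => `|x' s|)%R.
  by apply: (mx' _ idfun) => // y; exact: cvg_id.
have xf0' : is_bochner_integral mu D (pi0 \o x') f0.
  by apply: bochner_ae_eq xf0; apply: filterS xx' => s xs Ds /=; rewrite xs.
have xfin' : \int[mu]_(s in D) `|pi0 (x' s)|%:E < +oo.
  rewrite (@lower_integral_ae_eq _ _ _ mu D _ (fun s => `|pi0 (x s)|%:E))//.
  by apply: filterS xx' => s xs Ds /=; rewrite xs.
pose h1 := (h \_ D)%R.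
pose p := ((fun s => `|pi0 (x' s)|) \_ D)%R.
pose q := ((fun s => `|x' s|) \_ D)%R.
have mh1 : measurable_fun setT h1.
  by apply/(measurable_restrictT _ _).1 => //; exact: measurable_funTS.
have mp1 : measurable_fun setT p.
  by apply/(measurable_restrictT _ _).1 => //; exact: measurable_funTS.
have mq1 : measurable_fun setT q.
  by apply/(measurable_restrictT _ _).1 => //; exact: measurable_funTS.
pose F (st : measurableTypeR R * measurableTypeR R) : \bar R :=
  (h1 st.2 * Num.min (p st.1) (st.2 * q st.1))%:E.
have F0 st : 0 <= F st.
  rewrite /F lee_fin /h1 /p /q !patchE; case: ifPn => [t0|_]; last by rewrite mul0r.
  have {t0} t0 : (0 <= st.2)%R by move/set_mem/mem_half_line: t0 => /ltW.
  by rewrite mulr_ge0// le_min; case: ifPn => _ /=; rewrite ?mulr0 ?lexx ?normr_ge0 ?mulr_ge0.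
have mF : measurable_fun setT F.
  apply/measurable_EFinP/measurable_funM; first exact: measurableT_comp.
  apply: measurable_minr; first exact: measurableT_comp.
  by apply: measurable_funM => //; exact: measurableT_comp.
have inner t : (0 < t)%R -> (K f0 t)%:E <= \int[mu]_s (Num.min (p s) (t * q s))%:E.
  move=> t0; have := K_inter_le_integral t0 sx' mp mq xfin' xf0'.
  move=> /le_trans; apply; rewrite integral_mkcond; apply: lower_integral_le => s _.
    by rewrite patchE; case: ifPn => // _; rewrite lee_fin le_min normr_ge0 mulr_ge0// ltW.
  by rewrite /p /q !patchE; case: ifPn => // _; rewrite mulr0 minxx.
apply: (@le_trans _ _ (\int[mu]_t \int[mu]_s F (s, t))).
  rewrite integral_mkcond; apply: lower_integral_le => t _.
    rewrite patchE; case: ifPn => // /set_mem/mem_half_line t0.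
    by rewrite lee_fin mulr_ge0// K_inter_ge0// ltW.
  rewrite patchE; case: ifPn => [/[dup] tD /set_mem/mem_half_line t0|_]; last first.
    by rewrite integral_ge0.
  rewrite EFinM (_ : \int[mu]_s F (s, t) =
      (h t)%:E * \int[mu]_s (Num.min (p s) (t * q s))%:E).
    by apply: lee_wpmul2l; [rewrite lee_fin|exact: inner].
  rewrite -ge0_integralZl//.
  - by apply: eq_integral => s _; rewrite /F/= /h1 patchE tD EFinM.
  - by apply/measurable_EFinP/measurable_minr => //; exact: measurable_funM.
  - move=> s _; rewrite /p /q !patchE; case: ifPn => _; rewrite lee_fin le_min ?mulr0 ?lexx//.
    by rewrite normr_ge0 mulr_ge0// ltW.
  - by rewrite lee_fin.
rewrite -(fubini_tonelli F mF F0).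
apply: (@le_trans _ _ (\int[mu]_(s in D) (c%:E * W s))); last first.
  exact: lower_integralZ_le.
rewrite [leRHS]integral_mkcond.
apply: lower_integral_ae_le.
- by move=> s _; exact: integral_ge0.
- move=> s _; rewrite patchE; case: ifPn => // /set_mem Ds.
  by rewrite mule_ge0 ?W0// lee_fin ltW.
apply: filterS xx' => s xs _; rewrite patchE; case: ifPn => [/[dup] sD /set_mem Ds|sD].
  apply: (le_trans _ (hW _ Ds)); rewrite [leRHS]integral_mkcond.
  apply: lower_integral_le => // t _.
  rewrite /F/= /h1 /p /q !patchE sD xs//.
  by case: ifPn => // _; rewrite mul0r.
rewrite integral0_eq// => t _.
by rewrite /F/= /p /q !patchE (negbTE sD) mulr0 minxx mulr0.
Qed.

End tonelli.

(** * Step functions representing an element of the K-space *)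

Section bochner_indic.
Context d (T : measurableType d) (R : realType).
Variables (mu : {measure set T -> \bar R}) (D : set T).
Hypothesis mD : measurable D.
Local Open Scope ereal_scope.

Lemma bochner_indic (E : normedModType R) (A : set T) (e : E) :
  measurable A -> A `<=` D -> mu A < +oo ->
  is_bochner_integral mu D (fun x => (\1_A x : R) *: e)%R (fine (mu A) *: e)%R.
Proof.
move=> mA AD Afin.
pose s : T -> R^o := \1_A.
have ss : simple_on D s.
  split; last by move=> y; exact: (@measurable_indic _ _ R D A mA mD _ (measurable_set1 y)).
  apply: (@sub_finite_set _ _ [set 0%R; 1%R]) => // _ [x _ <-]; rewrite /s indicE.
  by case: (x \in A); [right|left].
have is_s : integrable_simple mu D s.
  split => // y y0; apply: le_lt_trans Afin; apply: le_measure.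
  - by apply/mem_set; exact: ss.2.
  - exact: mem_set.
  - move=> x [_ /=]; rewrite /s indicE => xy; apply: contrapT => nAx.
    by move: y0; rewrite -xy memNset// eqxx.
pose phi : R^o -> E := fun r => (r *: e)%R.
have phi0 : phi 0%R = 0%R by exact: scale0r.
have is_u := integrable_simple_comp phi0 is_s.
have intE : simple_integral mu D (phi \o s) = (fine (mu A) *: e)%R.
  rewrite (simple_integral_comp phi0 is_s).
  rewrite (fsbig_widen _ [set 0%R; 1%R]); last 2 first.
  - by move=> _ [x _ <-]; rewrite /s indicE; case: (x \in A); [right|left].
  - move=> y [_ /= ny]; rewrite (_ : _ `&` _ = set0) ?measure0 ?scale0r//.
    by apply/seteqP; split => // x [Dx /= sxy]; apply: ny; exists x.
  rewrite fsbigU//=; last first.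
    by move=> y [/= -> /eqP]; rewrite eq_sym oner_eq0.
  rewrite !fsbig_set1 phi0 scaler0 add0r /phi scale1r.
  congr (fine (mu _) *: e)%R; apply/seteqP; split => x /=.
    move=> [_]; rewrite /s indicE; case: (boolP (x \in A)) => [/set_mem//|_ /eqP].
    by rewrite eq_sym oner_eq0.
  by move=> Ax; split; [exact: AD|rewrite /s indicE mem_set].
exists (fun=> phi \o s); split.
- by move=> _; exact: is_u.1.
- by move=> _; exact: is_u.2.
- by apply: aeW => x _; exact: cvg_cst.
- rewrite (_ : (fun _ => _) = cst 0); first exact: cvg_cst.
  by apply/funext => n; apply: integral0_eq => x _; rewrite subrr normr0.
- by rewrite intE; exact: cvg_cst.
Qed.

Lemma bochner0 (E : normedModType R) :
  is_bochner_integral mu D (fun=> 0 : E)%R 0%R.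
Proof.
have := @bochner_indic E set0 0%R measurable0 (@sub0set _ D).
rewrite measure0 => /(_ (ltry _)); rewrite /= scale0r.
by rewrite (_ : (fun x => _) = fun=> 0%R)//; apply/funext => x; rewrite scaler0.
Qed.

Lemma bochner_sum_indic (E : normedModType R) (I : nat -> set T) (e : nat -> E) n :
  (forall k, measurable (I k)) -> (forall k, I k `<=` D) ->
  (forall k, mu (I k) < +oo) ->
  is_bochner_integral mu D (fun x => \sum_(k < n) (\1_(I k) x : R) *: e k)%R
    (\sum_(k < n) fine (mu (I k)) *: e k)%R.
Proof.
move=> mI ID Ifin; elim: n => [|n IHn].
  rewrite big_ord0 (_ : (fun x => _) = fun=> 0%R); first exact: bochner0.
  by apply/funext => x; rewrite big_ord0.
rewrite big_ord_recr/=.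
rewrite (_ : (fun x => _) = (fun x => \sum_(k < n) (\1_(I k) x : R) *: e k +
    (\1_(I n) x : R) *: e n)%R); last by apply/funext => x; rewrite big_ord_recr.
by apply: bochnerD => //; exact: bochner_indic.
Qed.

Lemma simple_on_cst (E : normedModType R) (e : E) : simple_on D (fun=> e).
Proof.
split; first by apply: (@sub_finite_set _ _ [set e]) => // _ [x _ <-].
by move=> y; rewrite preimage_cst; case: ifP => _; rewrite ?setIT ?setI0.
Qed.

Lemma simple_on_sum_indic (E : normedModType R) (I : nat -> set T) (e : nat -> E) n :
  (forall k, measurable (I k)) ->
  simple_on D (fun x => \sum_(k < n) (\1_(I k) x : R) *: e k)%R.
Proof.
move=> mI; elim: n => [|n IHn].
  rewrite (_ : (fun x => _) = fun=> 0%R); first exact: simple_on_cst.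
  by apply/funext => x; rewrite big_ord0.
rewrite (_ : (fun x => _) = (fun x => \sum_(k < n) (\1_(I k) x : R) *: e k +
    (\1_(I n) x : R) *: e n)%R); last by apply/funext => x; rewrite big_ord_recr.
have sn := simple_onZ_indic mD (simple_on_cst (e n)) (mI n).
exact: (simple_on_comp (fun p : E * E => p.1 + p.2)%R (simple_on_pair IHn sn)).
Qed.

Lemma integral_cells_le (I : nat -> set T) (G : T -> \bar R) (b : nat -> R) :
  (forall k, measurable (I k)) -> (forall k, 0 <= b k)%R ->
  (forall x, D x -> 0 <= G x) ->
  (forall k x, I k x -> G x <= (b k)%:E) ->
  (forall x, D x -> (forall k, ~ I k x) -> G x = 0) ->
  \int[mu]_(x in D) G x <= \sum_(k <oo) (b k)%:E * mu (I k).
Proof.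
move=> mI b0 G0 Gb Gz.
have bI0 k x : 0 <= (b k * \1_(I k) x)%:E by rewrite lee_fin mulr_ge0.
apply: (@le_trans _ _ (\int[mu]_(x in D) \sum_(k <oo) (b k * \1_(I k) x)%:E)).
  apply: lower_integral_le => // x Dx.
  have [[k Ikx]|nI] := pselect (exists k, I k x); last first.
    rewrite Gz//; first exact: nneseries_ge0.
    by move=> k Ikx; apply: nI; exists k.
  apply: (@le_trans _ _ (\sum_(0 <= i < k.+1) (b i * \1_(I i) x)%:E)); last first.
    exact: nneseries_lim_ge.
  rewrite big_nat_recr//= indicE mem_set// mulr1.
  by rewrite (le_trans (Gb _ _ Ikx))// leeDr// sume_ge0.
rewrite integral_nneseries//; last first.
  move=> k; apply/measurable_EFinP; apply: measurable_funM.
    exact: measurable_cst.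
  exact: measurable_indic.
apply: lee_nneseries => [*|k *]; first exact: integral_ge0.
under eq_integral do rewrite EFinM.
rewrite ge0_integralZl//; last 2 first.
- by apply/measurable_EFinP; exact: measurable_indic.
- by rewrite lee_fin.
rewrite integral_indic// lee_wpmul2l ?lee_fin//.
by apply: le_measure; [exact/mem_set/measurableI|exact: mem_set|exact: subIsetl].
Qed.

End bochner_indic.

Lemma sum_indic_disjoint (T : Type) (R : realType) (E : lmodType R)
    (I : nat -> set T) (e : nat -> E) n x :
  trivIset setT I ->
  (forall j, (j < n)%N -> I j x -> \sum_(k < n) (\1_(I k) x : R) *: e k = e j) /\
  ((forall j, (j < n)%N -> ~ I j x) -> \sum_(k < n) (\1_(I k) x : R) *: e k = 0).
Proof.
move=> tI; split => [j jn Ijx|nI].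
  rewrite (bigD1 (Ordinal jn))//= indicE mem_set// scale1r big1 ?addr0// => k kj.
  rewrite indicE memNset ?scale0r// => Ikx; move/eqP: kj; apply; apply: val_inj.
  by apply: tI => //; exists x.
by apply: big1 => k _; rewrite indicE memNset ?scale0r//; exact: nI.
Qed.

Section step_representation.
Context {R : realType} {V : topologicalLmodType R}.
Context {X0 X1 : completeNormedModType R} (C : compatible_couple V X0 X1).

Local Notation K f0 t := (K_functional (inter_couple C) (emb0 C f0) t).
Local Notation pi0 := (@inter_fst R V X0 X1 C).
Local Notation D := pos_half_line.
Local Notation mu := lebesgue_measure.

Variables (A h : R -> R).
Hypothesis A_dec : forall u v, 0 < u -> u < v -> A v < A u.
Hypothesis A_continuous : {in (pos_half_line : set R), continuous A}.
Hypothesis A_at_0 : A x @[x --> 0^'+] --> +oo.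
Hypothesis A_at_oo : A x @[x --> +oo] --> (0 : R).
Hypothesis h_measurable : measurable_fun setT h.
Hypothesis h_ge0 : forall z, 0 <= h z.
Hypothesis h_integral : forall u v, 0 < u -> u <= v ->
  (\int[lebesgue_measure]_(z in `]u, v]) (h z)%:E)%E = (A u - A v)%:E.

(** On ]t (k+1), t k] the density h has mass 2 ^ k * A s, so that the integral
    dominates the corresponding lower Riemann sum. *)
Lemma sum_levels_le (t : nat -> R) (s : R) f0 n :
  (forall k, 0 < t k) -> (forall k, A (t k) = 2 ^+ k * A s) ->
  (forall k, t k.+1 < t k) ->
  (\sum_(0 <= k < n) (2 ^+ k * A s * K f0 (t k.+1))%:E <=
   \int[mu]_(z in D) (h z * K f0 z)%:E)%E.
Proof.
move=> t0 tA tS; have mD := @measurable_half_line R.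
pose J k : set (measurableTypeR R) := `]t k.+1, t k]%classic.
have mJ k : measurable (J k) by exact: measurable_itv.
have JD k : J k `<=` D.
  move=> z; rewrite /J/= in_itv/= => /andP[tz _]; apply/mem_half_line.
  exact: lt_trans tz.
have tJ : trivIset setT J.
  by apply: trivIset_nonincreasing_cells => k; exact: ltW.
have K0 k : 0 <= K f0 (t k) by apply: K_inter_ge0; exact: ltW.
pose f k (z : measurableTypeR R) := (K f0 (t k.+1) * (h z * \1_(J k) z))%:E.
have mh k : measurable_fun D (fun z => h z * \1_(J k) z).
  apply: measurable_funM.
    exact: measurable_funTS.
  exact: (@measurable_indic _ (measurableTypeR R) R D (J k) (mJ k)).
have mf k : measurable_fun D (f k).
  apply/measurable_EFinP/measurable_funM; first exact: measurable_cst.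
  exact: mh.
have f0_ k z : (0 <= f k z)%E by rewrite lee_fin mulr_ge0// mulr_ge0.
have intf k : (\int[mu]_(z in D) f k z)%E = (2 ^+ k * A s * K f0 (t k.+1))%:E.
  rewrite /f; under eq_integral do rewrite EFinM.
  rewrite ge0_integralZl; last 4 first.
  - exact: mD.
  - by apply/measurable_EFinP; exact: mh.
  - by move=> z _; rewrite lee_fin mulr_ge0.
  - by rewrite lee_fin.
  rewrite mulrC EFinM; congr (_ * _)%E.
  transitivity (\int[mu]_(z in J k) (h z)%:E)%E.
    rewrite [RHS]integral_mkcond [LHS]integral_mkcond; apply: eq_integral => z _.
    rewrite !patchE indicE; case: (boolP (z \in J k)) => [/set_mem/JD/mem_set->|_].
      by rewrite mulr1.
    by rewrite mulr0; case: ifP.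
  rewrite h_integral//; last exact: ltW.
  by rewrite !tA exprS; congr EFin; ring.
rewrite -(eq_bigr _ (fun k _ => intf k)) -ge0_integral_sum//.
apply: lower_integral_le => z /mem_half_line z0; first by rewrite sume_ge0.
rewrite /f sumEFin lee_fin big_mkord.
have -> : \sum_(k < n) K f0 (t k.+1) * (h z * \1_(J k) z) =
    h z * \sum_(k < n) \1_(J k) z * K f0 (t k.+1).
  by rewrite mulr_sumr; apply: eq_bigr => k _; rewrite mulrC mulrA.
rewrite ler_wpM2l//.
have [Jsum nJsum] := sum_indic_disjoint (fun k => K f0 (t k.+1) : R^o) n z tJ.
have [[j jn Jj]|nJ] := pselect (exists2 j, (j < n)%N & J j z).
  rewrite (Jsum _ jn Jj) K_inter_nondecreasing ?ltW//.
  by move: Jj; rewrite /J/= in_itv/= => /andP[].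
rewrite nJsum; last by move=> j jn Jj; apply: nJ; exists j.
by apply: K_inter_ge0; exact: ltW.
Qed.

(** The fundamental lemma of interpolation theory, discretized along the levels of
    A. Near-optimal splittings f0 = (f0 - H k) + H k at the points T k give the
    telescoping series f0 = sum of u k with u k = H (k+1) - H k, and u k is spread
    uniformly over a cell just to the right of T (k+1). As h has mass comparable
    to A (T (k+1)) on the cell of T k, the sum of the A (T (k+1)) * K (T k) is
    bounded by the integral of h * K. The constant 32 is the product of 4 for the
    difference u k of two near-optimal parts, of 2 for the variation of the
    J-functional over a cell, and of 4 for the quotient of A (T (k+1)) by the mass
    of h. *)
Lemma exists_step_representation f0 :
  (\int[mu]_(z in D) (h z * K f0 z)%:E < +oo)%E ->
  exists x : R -> inter_space C, [/\ strongly_measurable mu D x,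
    is_bochner_integral mu D (pi0 \o x) f0,
    forall s, 1 < s -> x s = 0 &
    (\int[mu]_(s in D) (A s * Num.max `|pi0 (x s)| (s * `|x s|))%:E <=
     32%:E * \int[mu]_(z in D) (h z * K f0 z)%:E)%E].
Proof.
move=> Nfin; set N := (\int[mu]_(z in D) _)%E in Nfin *.
have mD := @measurable_half_line R.
have Apos := weight_gt0 A_dec A_at_oo.
(* the level below A 1 leaves room for a cell with left end T 0 = 1 *)
have [s s0 As] : exists2 s, 0 < s & A s = A 1 / 2.
  by apply: weight_surjective => //; rewrite divr_gt0 ?Apos.
have As0 : 0 < A s by exact: Apos.
have [t [_ t0 tA tS _]] := weight_levels A_dec A_continuous A_at_0 A_at_oo s0.
have Alt := weight_lt A_dec.
have t1 : t 1%N = 1.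
  have A1 : A (t 1%N) = A 1 by rewrite tA As expr1 mulrC divfK.
  by apply/eqP; rewrite eq_le !leNgt -(Alt _ _ (t0 _) ltr01) -(Alt _ _ ltr01 (t0 _)) A1 ltxx.
pose T k := t k.+1.
have T0 k : 0 < T k by exact: t0.
have TS k : T k.+1 < T k by exact: tS.
have T_le k : T k <= 1.
  rewrite -t1; apply: (nonincreasing_seqP T).1 => // i; exact: ltW.
pose Kt k := K f0 (T k).
have Kt0 k : 0 <= Kt k by apply: K_inter_ge0; exact: ltW.
have KtS k : Kt k.+1 <= Kt k by apply: K_inter_nondecreasing; exact: ltW.
pose c k := 2 ^+ k * A s * Kt k.
have c0 k : 0 <= c k by rewrite mulr_ge0// mulr_ge0 ?exprn_ge0// ltW.
have c_sum n : (\sum_(0 <= k < n) (c k)%:E <= N)%E by exact: sum_levels_le.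
have N0 : (0 <= N)%E by have := c_sum 0%N; rewrite big_nil.
pose M := fine N / A s.
have M0 : 0 <= M by rewrite divr_ge0 ?fine_ge0// ltW.
have Kt_le k : Kt k <= M * 2^-1 ^+ k.
  have : ((c k)%:E <= N)%E.
    apply: le_trans (c_sum k.+1); rewrite big_nat_recr//= leeDr// sume_ge0//.
    by move=> i _; rewrite lee_fin.
  rewrite -(fineK (_ : N \is a fin_num)) ?ge0_fin_numE// lee_fin /c => cN.
  rewrite exprVn ler_pdivlMr ?exprn_gt0// /M ler_pdivlMr//.
  by have -> : Kt k * 2 ^+ k * A s = 2 ^+ k * A s * Kt k by ring.
(* near-optimal splittings of f0 at the points T k, trivial at T 0 = 1 *)
have /choice[H HP] k : exists y, (k = 0%N -> y = 0) /\
    `|f0 - pi0 y| + T k * `|y| <= 2 * Kt k.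
  case: k => [|k]; last first.
    by have [y yP] := K_inter_almost_optimal C f0 (T0 k.+1); exists y.
  exists 0; split => //; rewrite (_ : pi0 0 = 0) ?subr0 ?normr0 ?mulr0 ?addr0; last exact: linear0.
  have := min_norm_le_K_inter C f0 (@ler01 R).
  rewrite minxx mul1r /Kt /T t1 => /le_trans; apply.
  by rewrite ler_peMl ?ler1n// K_inter_ge0.
have H0 : H 0%N = 0 by exact: (HP 0%N).1.
pose u k := H k.+1 - H k.
have g_le k : `|f0 - pi0 (H k)| <= 2 * Kt k.
  by apply: le_trans (HP k).2; rewrite lerDl mulr_ge0// ltW.
have h_le k : T k * `|H k| <= 2 * Kt k.
  by apply: le_trans (HP k).2; rewrite lerDr.
have fst_u k : `|pi0 (u k)| <= 4 * Kt k.
  have -> : pi0 (u k) = (f0 - pi0 (H k)) - (f0 - pi0 (H k.+1)).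
    by rewrite /u linearB opprB [in RHS]addrC addrA subrK.
  rewrite (le_trans (ler_normB _ _))//.
  by have := g_le k; have := g_le k.+1; have := KtS k; lra.
have norm_u k : T k.+1 * `|u k| <= 4 * Kt k.
  apply: (@le_trans _ _ (T k.+1 * (`|H k.+1| + `|H k|))).
    by rewrite ler_wpM2l ?ler_normB// ltW.
  have : T k.+1 * `|H k| <= T k * `|H k| by rewrite ler_wpM2r// ltW.
  by rewrite mulrDr; have := h_le k; have := h_le k.+1; have := KtS k; lra.
(* below 2 * T k.+1 the J-functional is controlled, up to T k the cells are disjoint *)
pose r k := Num.min (2 * T k.+1) (T k).
have Tr k : T k.+1 < r k by rewrite lt_min TS andbT ltr_pMl// ltr1n.
pose l k := r k - T k.+1.
have l0 k : 0 < l k by rewrite subr_gt0.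
pose I k : set (measurableTypeR R) := `]T k.+1, r k]%classic.
have mI k : measurable (I k) by exact: measurable_itv.
have muI k : mu (I k) = (l k)%:E.
  by rewrite [LHS](stieltjes_measure_oc idfun)//; exact: ltW.
have I_cell k : I k `<=` `]T k.+1, T k].
  move=> z; rewrite /I/= !in_itv/= => /andP[-> zr].
  by rewrite (le_trans zr)// ge_min lexx orbT.
have ID k : I k `<=` D.
  move=> z /I_cell; rewrite /= in_itv/= => /andP[Tz _]; apply/mem_half_line.
  exact: lt_trans Tz.
have tI : trivIset setT I.
  have tT := trivIset_nonincreasing_cells (fun k => ltW (TS k)).
  move=> i j _ _ [z [zi zj]]; apply: tT => //.
  by exists z; split; exact: I_cell.
pose d k := (l k)^-1 *: u k.
pose x z := if pselect (exists k, I k z) is left ex then d (projT1 (cid ex)) else 0.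
have xI k z : I k z -> x z = d k.
  move=> Ikz; rewrite /x; case: pselect => [ex|nI]; last by exfalso; apply: nI; exists k.
  case: cid => j /= Ijz; congr d; apply: tI => //.
  by exists z.
have xnI z : (forall k, ~ I k z) -> x z = 0.
  by move=> nI; rewrite /x; case: pselect => // ex; have [k] := ex; move/nI.
pose xn n z := \sum_(k < n) (\1_(I k) z : R) *: d k.
have xnE n k z : I k z -> (k < n)%N -> xn n z = x z.
  move=> Ikz kn; have [sumE _] := sum_indic_disjoint d n z tI.
  by rewrite (xI _ _ Ikz) /xn (sumE _ kn Ikz).
have xn0 n z : (forall j, (j < n)%N -> ~ I j z) -> xn n z = 0.
  by have [_ sum0] := sum_indic_disjoint d n z tI; exact: sum0.
have sx : strongly_measurable mu D x.
  exists xn; split; first by move=> n; exact: simple_on_sum_indic.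
  apply: aeW => z _; have [[k Ikz]|nI] := pselect (exists k, I k z).
    apply: cvg_near_cst; exists k.+1 => // n /= kn.
    exact: (@xnE n k).
  have nI' k : ~ I k z by move=> Ikz; apply: nI; exists k.
  by apply: cvg_near_cst; apply: nearW => n; rewrite xnI// xn0.
have int_tail n : (\int[mu]_(z in D) `|pi0 (x z) - pi0 (xn n z)|%:E <=
    (8 * M * 2^-1 ^+ n)%:E)%E.
  pose J k := I (k + n)%N; pose b k := `|pi0 (d (k + n)%N)|.
  apply: (le_trans (@integral_cells_le _ _ _ mu D mD J _ b _ _ _ _ _)) => //.
  - by move=> k; exact: mI.
  - by move=> k; exact: normr_ge0.
  - move=> k z Ikz; rewrite (xI _ _ Ikz) xn0; last first.
      move=> j jn Ijz; suff jk : j = (k + n)%N by rewrite jk ltnNge leq_addl in jn.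
      by apply: tI => //; exists z.
    by rewrite (_ : pi0 0 = 0) ?subr0//; exact: linear0.
  - move=> z _ nJ; have [[j Ijz]|nI] := pselect (exists k, I k z).
      have jn : (j < n)%N.
        by rewrite ltnNge; apply/negP => nj; apply: (nJ (j - n)%N); rewrite /J subnK.
      by rewrite (xnE _ _ _ Ijz jn) subrr normr0.
    have nI' k : ~ I k z by move=> Ikz; apply: nI; exists k.
    by rewrite xnI// xn0// subrr normr0.
  apply: nneseries_le => [k|m]; first by rewrite mule_ge0// lee_fin /b.
  apply: (@le_trans _ _ (\sum_(0 <= k < m) (4 * M * 2^-1 ^+ n * 2^-1 ^+ k)%:E)%E).
    apply: lee_sum => k _.
    rewrite [X in (_ * X <= _)%E](_ : _ = (l (k + n)%N)%:E); last exact: muI.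
    rewrite -EFinM lee_fin /b /d linearZ/= normrZ.
    rewrite ger0_norm ?invr_ge0 ?(ltW (l0 _))// mulrC mulrA mulfV ?gt_eqF// mul1r.
    rewrite (le_trans (fst_u _))//.
    have -> : 4 * M * 2^-1 ^+ n * 2^-1 ^+ k = 4 * (M * 2^-1 ^+ (k + n)).
      by rewrite exprD; ring.
    by rewrite ler_pM2l.
  rewrite sumEFin lee_fin -mulr_sumr.
  have -> : 8 * M * 2^-1 ^+ n = 4 * M * 2^-1 ^+ n * 2 by ring.
  by rewrite ler_wpM2l ?sum_half_powers// mulr_ge0 ?exprn_ge0// mulr_ge0.
have sfx : strongly_measurable mu D (pi0 \o x).
  exact: (strongly_measurable_comp (@inter_fst_continuous _ _ _ _ C)).
have xf0 : is_bochner_integral mu D (pi0 \o x) f0.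
  have [z xz] : exists z, is_bochner_integral mu D (pi0 \o x) z.
    apply: bochner_exists => //.
    apply: (@le_lt_trans _ _ (8 * M * 2^-1 ^+ 0)%:E); last exact: ltry.
    apply: le_trans (int_tail 0%N); apply: lower_integral_le => // y _.
    by rewrite lee_fin /xn big_ord0 (_ : pi0 0 = 0) ?subr0//; exact: linear0.
  suff -> : f0 = z by [].
  have xnH n : is_bochner_integral mu D (xn n) (H n).
    have -> : H n = \sum_(k < n) fine (mu (I k)) *: d k.
      transitivity (\sum_(k < n) u k).
        by rewrite -(big_mkord xpredT u) telescope_sumr// H0 subr0.
      apply: eq_bigr => k _; rewrite (_ : fine _ = l k); last by rewrite [mu _]muI.
      by rewrite /d scalerA mulfV ?scale1r// gt_eqF.
    apply: bochner_sum_indic => // k; rewrite [X in (X < _)%E](_ : _ = (l k)%:E).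
      exact: ltry.
    exact: muI.
  have dist n : `|f0 - z| <= 10 * M * 2^-1 ^+ n.
    have zn : `|z - pi0 (H n)| <= 8 * M * 2^-1 ^+ n.
      have := bochner_contraction (@inter_fst_norm _ _ _ _ C) (xnH n).
      move=> /(@bochnerN _ _ _ mu D) /(bochnerD mD xz) /(bochner_norm_le mD).
      by move=> /le_trans/(_ (int_tail n)); rewrite lee_fin.
    have := g_le n; have := Kt_le n.
    rewrite (_ : f0 - z = (f0 - pi0 (H n)) - (z - pi0 (H n))); last first.
      by rewrite opprB addrA subrK.
    have := ler_normB (f0 - pi0 (H n)) (z - pi0 (H n)).
    by rewrite -!mulrA in zn *; lra.
  apply/eqP; rewrite -subr_eq0 -normr_le0.
  have cvg_0 : 10 * M * 2^-1 ^+ n @[n --> \oo] --> (0 : R).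
    rewrite -[X in _ --> X](mulr0 (10 * M)); apply: cvgM; first exact: cvg_cst.
    by apply: cvg_expr; rewrite ger0_norm ?invr_ge0// invf_lt1// ltr1n.
  rewrite -(cvg_lim _ cvg_0)//; apply: limr_ge; last exact: nearW.
  by apply/cvg_ex; exists 0.
exists x; split => //.
- move=> z z1; apply: xnI => k /I_cell; rewrite /= in_itv/= => /andP[_ zT].
  by have := lt_le_trans z1 (le_trans zT (T_le k)); rewrite ltxx.
pose b k := A (T k.+1) * (2 * ((l k)^-1 * (4 * Kt k))).
apply: (le_trans (@integral_cells_le _ _ _ mu D mD I _ b _ _ _ _ _)) => //.
- move=> k; rewrite /b mulr_ge0 ?(ltW (Apos _ (T0 _)))// !mulr_ge0//.
  by rewrite invr_ge0 ltW.
- move=> z /mem_half_line z0; rewrite lee_fin mulr_ge0 ?(ltW (Apos _ z0))//.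
  by rewrite le_max normr_ge0.
- move=> k z Ikz; rewrite (xI _ _ Ikz) lee_fin /b.
  move: (Ikz); rewrite /I/= in_itv/= => /andP[Tz zr].
  have z2 : z <= 2 * T k.+1 by rewrite (le_trans zr)// ge_min lexx.
  apply: ler_pM.
  + by rewrite ltW// Apos// (lt_trans (T0 k.+1)).
  + by rewrite le_max normr_ge0.
  + by rewrite ltW// A_dec.
  rewrite /d linearZ/= !normrZ ger0_norm ?invr_ge0 ?(ltW (l0 _))//.
  rewrite mulrCA [leRHS]mulrCA -maxr_pMr ?invr_ge0 ?(ltW (l0 _))//.
  rewrite ler_wpM2l ?invr_ge0 ?(ltW (l0 _))// ge_max; apply/andP; split.
    by have := fst_u k; have := Kt0 k; lra.
  apply: (@le_trans _ _ (2 * T k.+1 * `|u k|)); first by rewrite ler_wpM2r.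
  by rewrite -mulrA ler_pM2l.
- move=> z _ nI; rewrite xnI// (_ : pi0 0 = 0); last exact: linear0.
  by rewrite !normr0 mulr0 maxxx mulr0.
apply: nneseries_le => [k|n].
  rewrite mule_ge0// lee_fin /b mulr_ge0 ?(ltW (Apos _ (T0 _)))// !mulr_ge0//.
  by rewrite invr_ge0 ltW.
rewrite (eq_bigr (fun k => 32%:E * (c k)%:E)%E); last first.
  move=> k _; rewrite [X in (_ * X)%E](_ : _ = (l k)%:E); last exact: muI.
  rewrite -!EFinM; congr EFin; rewrite /b /c /T tA !exprS.
  by field; rewrite gt_eqF.
rewrite -ge0_sume_distrr; last by move=> k _; rewrite lee_fin.
by apply: lee_wpmul2l; [rewrite lee_fin|exact: c_sum].
Qed.

End step_representation.

(** * Embeddings between J-spaces and the K-space *)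

Section embeddings.
Context {R : realType} {T : Type}.
Implicit Types E F G : normed_subset R T.

Definition embeds E F := exists2 c : R, 0 < c & forall f, carrier E f ->
  carrier F f /\ (subset_norm F f <= c%:E * subset_norm E f)%E.

Lemma embeds_trans E F G : embeds E F -> embeds F G -> embeds E G.
Proof.
move=> [c c0 EF] [d d0 FG]; exists (d * c); first exact: mulr_gt0.
move=> f /EF[Ff fle]; have [Gf gle] := FG _ Ff; split => //.
rewrite (le_trans gle)// EFinM -muleA lee_wpmul2l//.
by rewrite lee_fin ltW.
Qed.

Lemma embeds_equal_spaces E F : embeds E F -> embeds F E -> equal_spaces E F.
Proof.
move=> [c c0 EF] [d d0 FE]; split.
  by apply/seteqP; split => f; [move=> /EF[]|move=> /FE[]].
exists d^-1, c; split; rewrite ?invr_gt0// => f Ef; have [Ff fle] := EF _ Ef.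
split => //; have [_ efle] := FE _ Ff.
rewrite -(@lee_pmul2l _ d%:E) ?lte_fin//.
by rewrite muleA -EFinM mulfV ?gt_eqF// mul1e.
Qed.

End embeddings.

Section interpolation_embeddings.
Context {R : realType} {V : topologicalLmodType R}.
Context {X0 X1 : completeNormedModType R} (C : compatible_couple V X0 X1).

Lemma J_space_embeds (w : R -> R) (F : normed_subset R V) (c : R) : 0 < c ->
  (forall f u, J_representation f u ->
    (L1_norm (fun t => (t^-1 * w t * J_functional (u t : inter_space C) t)%R) < +oo)%E ->
    carrier F f /\ (subset_norm F f <=
      c%:E * L1_norm (fun t => (t^-1 * w t * J_functional (u t) t)%R))%E) ->
  embeds (J_space C w) F.
Proof.
move=> c0 Fle; exists c => // f [fsum _ /= Jfin].
have Ff : carrier F f.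
  by have [_ [u fu <-] ufin] := ereal_inf_lt Jfin; exact: (Fle f u fu ufin).1.
split => //.
suff : (c^-1%:E * subset_norm F f <= J_norm C w f)%E.
  rewrite -(@lee_pmul2l _ c%:E) ?lte_fin//.
  by rewrite muleA -EFinM mulfV ?gt_eqF// mul1e.
apply: le_ereal_inf_tmp => _ [u fu <-].
have [ufin|] := boolP (L1_norm (fun t => (t^-1 * w t * J_functional (u t) t)%R) < +oo)%E.
  rewrite -(@lee_pmul2l _ c%:E) ?lte_fin//.
  by rewrite muleA -EFinM mulfV ?gt_eqF// mul1e; exact: (Fle f u fu ufin).2.
by rewrite -leNgt leye_eq => /eqP ->; rewrite leey.
Qed.

Lemma embeds_J_space (w : R -> R) (E : normed_subset R V) (c : R) : 0 < c ->
  (forall f, carrier E f -> f \in sum_pred C /\ (subset_norm E f < +oo)%E /\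
    exists2 u, J_representation f u &
    (L1_norm (fun t => (t^-1 * w t * J_functional (u t : inter_space C) t)%R) <=
      c%:E * subset_norm E f)%E) ->
  embeds E (J_space C w).
Proof.
move=> c0 Ele; exists c => // f Ef; have [fsum [Efin [u fu ule]]] := Ele _ Ef.
have Jle : (J_norm C w f <=
    L1_norm (fun t => (t^-1 * w t * J_functional (u t) t)%R))%E.
  by apply: ereal_inf_lbound; exists u.
split; last exact: le_trans ule.
split => //; first by exists u.
apply: (le_lt_trans Jle); apply: (le_lt_trans ule).
by rewrite lte_mul_pinfty// lee_fin ltW.
Qed.

End interpolation_embeddings.

Section intersection_couple.
Context {R : realType} {V : topologicalLmodType R}.
Context {X0 X1 : completeNormedModType R} (C : compatible_couple V X0 X1).

Local Notation K f0 t := (K_functional (inter_couple C) (emb0 C f0) t).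
Local Notation pi0 := (@inter_fst R V X0 X1 C).
Local Notation D := pos_half_line.
Local Notation mu := lebesgue_measure.

Lemma wrap_subproof (y : inter_space C) :
  (pi0 y, y) \in inter_pred (inter_couple C).
Proof. exact/inter_predP. Qed.

(** The intersection of X0 with the intersection of X0 and X1 is the latter. *)
Definition wrap (y : inter_space C) : inter_space (inter_couple C) :=
  InterSpace (wrap_subproof y).

Fact wrap_linear : linear wrap.
Proof.
by move=> k x y; apply: val_inj; apply/pair_eqP/andP; split; apply/eqP.
Qed.

HB.instance Definition _ := GRing.isLinear.Build R (inter_space C)
  (inter_space (inter_couple C)) *:%R wrap wrap_linear.

Lemma wrap_continuous : continuous wrap.
Proof.
apply: contraction_continuous => y.
by rewrite inter_norm_val prod_normE/= ge_max lexx inter_fst_norm.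
Qed.

Definition unwrap (y : inter_space (inter_couple C)) : inter_space C :=
  (inter_val y).2.

Lemma unwrap_continuous : continuous unwrap.
Proof.
move=> y; apply: (@continuous_comp _ _ _ (@inter_val _ _ _ _ (inter_couple C)) snd).
  exact: inter_val_continuous.
exact: cvg_snd.
Qed.

Lemma fst_unwrap y : pi0 (unwrap y) = inter_fst y.
Proof.
apply: (emb0_inj (c := C)).
exact/esym/(elimT (inter_predP _ _) (inter_valP y)).
Qed.

Lemma sum_pred_interP (f : V) :
  f \in sum_pred (inter_couple C) <-> exists f0, f = emb0 C f0.
Proof.
split=> [/asboolP[[x y] /= ->]|[f0 ->]].
  by exists (x + pi0 y); rewrite linearD.
exact: (fst_to_sum_subproof (inter_couple C)).
Qed.

Section weights.
Variables (A h B : R -> R) (M : R).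
Hypothesis A_dec : forall u v, 0 < u -> u < v -> A v < A u.
Hypothesis A_continuous : {in (pos_half_line : set R), continuous A}.
Hypothesis A_at_0 : A x @[x --> 0^'+] --> +oo.
Hypothesis A_at_oo : A x @[x --> +oo] --> (0 : R).
Hypothesis M_gt0 : 0 < M.
Hypothesis A_sv : forall u v, 0 < u -> u <= v ->
  u `^ 2^-1 * A u <= M * (v `^ 2^-1 * A v).
Hypothesis h_measurable : measurable_fun setT h.
Hypothesis h_ge0 : forall z, 0 <= h z.
Hypothesis h_integral : forall u v, 0 < u -> u <= v ->
  (\int[lebesgue_measure]_(z in `]u, v]) (h z)%:E)%E = (A u - A v)%:E.
Hypothesis h_B : {ae @lebesgue_measure R, forall z, 0 < z -> h z = z^-1 * B z}.

Lemma K_norm_density f0 : K_norm (inter_couple C) B (emb0 C f0) =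
  (\int[mu]_(t in D) (h t * K f0 t)%:E)%E.
Proof.
apply: lower_integral_ae_eq.
- by move=> t _; rewrite lee_fin.
- by move=> t /mem_half_line t0; rewrite lee_fin mulr_ge0// K_inter_ge0// ltW.
move: h_B; apply: ae_lebesgue_imply => t hB /mem_half_line t0.
by rewrite -hB// ger0_norm// mulr_ge0// K_inter_ge0// ltW.
Qed.

(** The common half of both inclusions of J-spaces into the K-space; the weight w
    and the functional J enter only through two pointwise estimates. *)
Lemma K_norm_le_of_bochner (y : R -> inter_space C) (w J : R -> R) (c1 c2 : R) :
  strongly_measurable mu D y -> 0 < c1 -> 0 < c2 ->
  (forall s, 0 < s -> 0 <= w s * J s) ->
  (forall s, 0 < s -> exists2 r, 0 < r &
     A r * Num.max `|pi0 (y s)| (r * `|y s|) <= c1 * (w s * J s)) ->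
  (forall s, 0 < s -> `|pi0 (y s)| <= c2 * (w s * J s)) ->
  (L1_norm (fun s => (s^-1 * w s * J s)%R) < +oo)%E ->
  (\int[mu]_(s in D) `|s^-1 *: pi0 (y s)|%:E < +oo)%E /\
  (forall f0, is_bochner_integral mu D (fun s => s^-1 *: pi0 (y s)) f0 ->
   (K_norm (inter_couple C) B (emb0 C f0) <=
     ((1 + 2 * M ^+ 2) * c1)%:E * L1_norm (fun s => (s^-1 * w s * J s)%R))%E).
Proof.
move=> sy c10 c20 wJ0 wJ1 wJ2 wJfin.
have wJE s : 0 < s -> `|s^-1 * w s * J s| = s^-1 * (w s * J s).
  by move=> s0; rewrite -mulrA ger0_norm// mulr_ge0 ?wJ0// invr_ge0 ltW.
have fst_fin : (\int[mu]_(s in D) `|s^-1 *: pi0 (y s)|%:E < +oo)%E.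
  apply: (@le_lt_trans _ _ (\int[mu]_(s in D)
      (c2%:E * `|s^-1 * w s * J s|%:E))%E).
    apply: lower_integral_le => s /mem_half_line s0; first by rewrite lee_fin.
    rewrite -EFinM lee_fin wJE// normrZ ger0_norm ?invr_ge0 ?(ltW s0)//.
    by rewrite mulrCA ler_wpM2l ?invr_ge0 ?(ltW s0)// wJ2.
  apply: (le_lt_trans (lower_integralZ_le _ _ _)) => //.
    by rewrite lte_mul_pinfty// lee_fin ltW.
split=> // f0 yf0; rewrite K_norm_density.
pose x s := s^-1 *: y s.
have sx : strongly_measurable mu D x.
  apply: strongly_measurableZ => //; first exact: measurable_half_line.
  exact: measurable_inv_half_line.
have fst_x s : pi0 (x s) = s^-1 *: pi0 (y s) by rewrite /x linearZ.
have xf0 : is_bochner_integral mu D (pi0 \o x) f0.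
  by rewrite (_ : _ \o _ = (fun s => s^-1 *: pi0 (y s)))//; exact/funext.
apply: (integral_K_inter_le h_measurable h_ge0 sx xf0).
- by under eq_integral do rewrite fst_x.
- by rewrite mulr_gt0// ltr_wpDr// mulr_ge0// exprn_ge0// ltW.
- by move=> s _; rewrite lee_fin.
move=> s /mem_half_line s0; have [r r0 rle] := wJ1 _ s0.
have := density_kernel_le A_dec A_continuous A_at_0 A_at_oo h_measurable h_ge0
  h_integral r0 M_gt0 A_sv (normr_ge0 (pi0 (x s))) (normr_ge0 (x s)).
move=> /le_trans; apply; rewrite -EFinM lee_fin wJE// -mulrA ler_wpM2l//.
  by rewrite addr_ge0// mulr_ge0// exprn_ge0// ltW.
rewrite fst_x /x !normrZ ger0_norm ?invr_ge0 ?(ltW s0)//.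
rewrite [r * _]mulrCA -maxr_pMr ?invr_ge0 ?(ltW s0)//.
by rewrite mulrCA [leRHS]mulrCA ler_wpM2l// invr_ge0 ltW.
Qed.

Hypothesis A_gt0 : forall s, 0 < s -> 0 < A s.

Lemma J_embeds_K (a : R -> R) (l : R) : 0 < l ->
  (forall s, 0 < s -> l <= a s) -> (forall s, 0 < s <= 1 -> A s = a s) ->
  embeds (J_space C a) (K_space (inter_couple C) B).
Proof.
move=> l0 la Aa; have a1 : A 1 = a 1 by apply: Aa; rewrite ltr01 lexx.
have A1 := A_gt0 ltr01.
pose c1 := 1 + A 1 / l.
have c10 : 0 < c1 by rewrite addr_gt0// divr_gt0.
have a0 s : 0 < s -> 0 < a s by move=> s0; exact: lt_le_trans (la _ s0).
apply: (@J_space_embeds _ _ _ _ _ _ _ ((1 + 2 * M ^+ 2) * c1)).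
  by rewrite mulr_gt0// ltr_wpDr// mulr_ge0// exprn_ge0// ltW.
move=> f u fu ufin; have su := fu.1.
have J0 s : 0 <= J_functional (u s) s by rewrite le_max normr_ge0.
have fstJ s : `|pi0 (u s)| <= J_functional (u s) s by rewrite le_max lexx.
have est1 s : 0 < s -> exists2 r, 0 < r &
    A r * Num.max `|pi0 (u s)| (r * `|u s|) <= c1 * (a s * J_functional (u s) s).
  (* beyond 1 the weight a is comparable to the constant A 1, unlike A *)
  move=> s0; exists (Num.min 1 s); first by rewrite lt_min ltr01.
  set r := Num.min 1 s.
  have r0 : 0 < r by rewrite lt_min ltr01.
  have Ar : A r <= c1 * a s.
    have [s1|s1] := leP s 1.
      rewrite /r (min_idPr s1) Aa ?s0// ler_peMl ?(ltW (a0 _ s0))//.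
      by rewrite lerDl divr_ge0 ?ltW.
    rewrite /r (min_idPl (ltW s1)) (@le_trans _ _ (A 1 / l * a s))//.
      by rewrite mulrAC ler_pdivlMr// ler_wpM2l ?la// ltW.
    by rewrite ler_wpM2r ?(ltW (a0 _ s0))// lerDr.
  rewrite mulrA; apply: ler_pM => //; first exact/ltW/A_gt0.
    by rewrite le_max normr_ge0.
  rewrite ge_max fstJ/= inter_norm_val prod_normE maxr_pMr ?(ltW r0)//.
  rewrite ge_max; apply/andP; split.
    by rewrite (le_trans _ (fstJ s))// ler_piMl// /r ge_min lexx.
  by rewrite /J_functional le_max ler_wpM2r ?orbT// /r ge_min lexx orbT.
have est2 s : 0 < s -> `|pi0 (u s)| <= l^-1 * (a s * J_functional (u s) s).
  move=> s0; rewrite -ler_pdivrMl ?invr_gt0// invrK.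
  by rewrite ler_pM// ?la// ltW.
have aJ0 s : 0 < s -> 0 <= a s * J_functional (u s) s.
  by move=> s0; rewrite mulr_ge0// ltW// a0.
have li0 : 0 < l^-1 by rewrite invr_gt0.
have [fst_fin Kle] := K_norm_le_of_bochner (w := a)
  (J := fun s => J_functional (u s) s) su c10 li0 aJ0 est1 est2 ufin.
have [f0 f0E uf0] := bochner_of_J_representation fu fst_fin.
have Kf : (K_norm (inter_couple C) B f <=
    ((1 + 2 * M ^+ 2) * c1)%:E *
    L1_norm (fun t => (t^-1 * a t * J_functional (u t) t)%R))%E.
  by rewrite f0E; exact: Kle.
split => //; split; first by apply/sum_pred_interP; exists f0.
apply: (le_lt_trans Kf); rewrite lte_mul_pinfty// lee_fin.
by rewrite mulr_ge0 ?(ltW c10)// addr_ge0// mulr_ge0// exprn_ge0// ltW.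
Qed.

(** The weight A tends to 0, but s * A s stays away from 0 for s > 1, and there
    the J-functional of the couple of X0 and the intersection exceeds s times the
    norm in X0; this makes the representation absolutely convergent in X0. *)
Lemma J_inter_embeds_K M1 : 0 < M1 ->
  (forall u v, 0 < u -> u <= v -> u * A u <= M1 * (v * A v)) ->
  embeds (J_space (inter_couple C) A) (K_space (inter_couple C) B).
Proof.
move=> M10 A_sv1; have A1 := A_gt0 ltr01.
pose c2 := (1 + M1) / A 1.
have c20 : 0 < c2 by rewrite divr_gt0// addr_gt0.
apply: (@J_space_embeds _ _ _ _ _ _ _ ((1 + 2 * M ^+ 2) * 1)).
  by rewrite mulr1 ltr_wpDr// mulr_ge0// exprn_ge0// ltW.
move=> f u fu ufin.
pose y s := unwrap (u s).
have sy : strongly_measurable mu D y.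
  exact: (strongly_measurable_comp unwrap_continuous fu.1).
have fst_y s : pi0 (y s) = inter_fst (u s) by exact: fst_unwrap.
have JE s : J_functional (u s) s = Num.max `|pi0 (y s)| (s * `|y s|).
  by rewrite fst_y.
have AJ0 s : 0 < s -> 0 <= A s * J_functional (u s) s.
  by move=> s0; rewrite mulr_ge0 ?le_max ?normr_ge0// ltW// A_gt0.
have est1 s : 0 < s -> exists2 r, 0 < r &
    A r * Num.max `|pi0 (y s)| (r * `|y s|) <= 1 * (A s * J_functional (u s) s).
  by move=> s0; exists s => //; rewrite mul1r JE.
have est2 s : 0 < s -> `|pi0 (y s)| <= c2 * (A s * J_functional (u s) s).
  move=> s0; rewrite JE /c2 mulrAC ler_pdivlMr// mulrC.
  have As := A_gt0 s0; have J1 : `|pi0 (y s)| <= Num.max `|pi0 (y s)| (s * `|y s|).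
    by rewrite le_max lexx.
  set J := Num.max _ _ in J1 *.
  have J0 : 0 <= J by exact: le_trans J1.
  have [s1|s1] := leP s 1.
    apply: (@le_trans _ _ (A s * J)).
      apply: ler_pM => //; first exact: ltW.
      by move: s1; rewrite le_eqVlt => /predU1P[->//|/(A_dec s0)/ltW].
    by rewrite ler_peMl ?lerDl ?(ltW M10)// mulr_ge0// ltW.
  have sJ : s * `|pi0 (y s)| <= J.
    apply: (@le_trans _ _ (s * `|y s|)); last by rewrite le_max lexx orbT.
    by rewrite ler_wpM2l ?inter_fst_norm// ltW.
  apply: (@le_trans _ _ (M1 * (A s * J))); last first.
    by rewrite ler_wpM2r ?lerDr// mulr_ge0// ltW.
  apply: (@le_trans _ _ (M1 * (s * A s) * `|pi0 (y s)|)).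
    by rewrite ler_wpM2r// -[A 1]mul1r A_sv1// ltW.
  rewrite -!mulrA ler_wpM2l ?(ltW M10)// mulrCA ler_wpM2l ?(ltW As)//.
have [fst_fin Kle] := K_norm_le_of_bochner (w := A)
  (J := fun s => J_functional (u s) s) sy ltr01 c20 AJ0 est1 est2 ufin.
have fst_fin' :
    (\int[mu]_(s in D) `|s^-1 *: inter_fst (u s)|%:E < +oo)%E.
  by under eq_integral do rewrite -fst_y.
have [f0 f0E uf0] := bochner_of_J_representation fu fst_fin'.
have Kf : (K_norm (inter_couple C) B f <= ((1 + 2 * M ^+ 2) * 1)%:E *
    L1_norm (fun t => (t^-1 * A t * J_functional (u t) t)%R))%E.
  rewrite f0E; apply: Kle.
  rewrite (_ : (fun s => _) = (fun s => s^-1 *: inter_fst (u s)))//.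
  by apply/funext => s; rewrite fst_y.
split => //; split; first by apply/sum_pred_interP; exists f0.
apply: (le_lt_trans Kf); rewrite lte_mul_pinfty// lee_fin.
by rewrite mulr1 addr_ge0// mulr_ge0// exprn_ge0// ltW.
Qed.

(** The same step function represents f for both couples, because it vanishes on
    the half-line where the two J-functionals, and the two weights, differ. *)
Lemma K_space_step_representation f :
  carrier (K_space (inter_couple C) B) f ->
  exists f0 (x : R -> inter_space C), [/\ f = emb0 C f0,
    strongly_measurable mu D (fun s => s *: x s),
    is_bochner_integral mu D (fun s => s^-1 *: pi0 (s *: x s)) f0,
    forall s, 1 < s -> x s = 0 &
    (\int[mu]_(s in D) (A s * Num.max `|pi0 (x s)| (s * `|x s|))%:E <=
     32%:E * K_norm (inter_couple C) B f)%E].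
Proof.
move=> [/sum_pred_interP[f0 ->] /=]; rewrite K_norm_density => Kfin.
have [x [sx xf0 x0 xle]] := exists_step_representation A_dec A_continuous A_at_0
  A_at_oo h_measurable h_ge0 h_integral Kfin.
exists f0, x; split => //.
  apply: strongly_measurableZ => //; exact: measurable_half_line.
apply: bochner_ae_eq xf0; apply: aeW => s /mem_half_line s0 /=.
rewrite (_ : pi0 (s *: x s) = s *: pi0 (x s)); last exact: linearZ.
by rewrite scalerA mulVf ?scale1r// gt_eqF.
Qed.

Lemma K_embeds_J (a : R -> R) : (forall s, 0 < s <= 1 -> A s = a s) ->
  embeds (K_space (inter_couple C) B) (J_space C a).
Proof.
move=> Aa; apply: (@embeds_J_space _ _ _ _ _ _ _ 32) => // f Kf.
have [f0 [x [f0E sx xf0 x0 xle]]] := K_space_step_representation Kf.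
split; first by rewrite f0E; exact: fst_to_sum_subproof.
split; first exact: Kf.2.
exists (fun s => s *: x s).
  by rewrite f0E; exact: J_representation_of_bochner.
apply: le_trans xle; apply: lower_integral_le => s /mem_half_line s0.
  by rewrite lee_fin.
rewrite lee_fin; have As := A_gt0 s0.
have max0 : 0 <= Num.max `|pi0 (x s)| (s * `|x s|) by rewrite le_max normr_ge0.
have [s1|s1] := leP s 1; last first.
  rewrite x0// scaler0 /J_functional /= !normr0 mulr0 maxxx mulr0 normr0.
  by rewrite mulr_ge0// ltW.
rewrite -Aa ?s0//.
have -> : J_functional (s *: x s) s = s * Num.max `|pi0 (x s)| (s * `|(inter_val (x s)).2|).
  rewrite /J_functional /= !normrZ (ger0_norm (ltW s0)) mulrCA.
  by rewrite -maxr_pMr// ltW.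
set m := Num.max _ _.
have -> : s^-1 * A s * (s * m) = A s * m by field; rewrite gt_eqF.
rewrite ger0_norm ?mulr_ge0 ?(ltW As) ?le_max ?normr_ge0//.
rewrite ler_wpM2l ?(ltW As)// /m ge_max le_max lexx/= le_max; apply/orP; right.
by rewrite ler_wpM2l ?(ltW s0)// inter_norm_val prod_normE le_max lexx orbT.
Qed.

Lemma K_embeds_J_inter :
  embeds (K_space (inter_couple C) B) (J_space (inter_couple C) A).
Proof.
apply: (@embeds_J_space _ _ _ _ _ _ _ 32) => // f Kf.
have [f0 [x [f0E sx xf0 x0 xle]]] := K_space_step_representation Kf.
split; first exact: Kf.1.
split; first exact: Kf.2.
exists (fun s => wrap (s *: x s)).
  rewrite f0E; apply: (J_representation_of_bochner (C := inter_couple C)).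
    exact: (strongly_measurable_comp wrap_continuous sx).
  exact: xf0.
apply: le_trans xle; apply: lower_integral_le => s /mem_half_line s0.
  by rewrite lee_fin.
rewrite lee_fin; have As := A_gt0 s0.
have -> : J_functional (wrap (s *: x s)) s = s * Num.max `|pi0 (x s)| (s * `|x s|).
  rewrite /J_functional /= linearZ/= !normrZ (ger0_norm (ltW s0)).
  by rewrite -maxr_pMr// ltW.
set m := Num.max _ _.
have -> : s^-1 * A s * (s * m) = A s * m by field; rewrite gt_eqF.
by rewrite ger0_norm// mulr_ge0 ?(ltW As) ?le_max ?normr_ge0.
Qed.

End weights.

End intersection_couple.

Theorem theorem1p22 (R : realType) (V : topologicalLmodType R)
    (X0 X1 : completeNormedModType R) (C : compatible_couple V X0 X1)
    (a alpha A B : R -> R) (c : R)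
    (a_sv : slowly_varying a) (a_ac : locally_abs_continuous a)
    (a_decr : strictly_decreasing a)
    (a_at_0 : a x @[x --> 0^'+] --> +oo)
    (a_at_oo : exists2 l : R, 0 < l & a x @[x --> +oo] --> l)
    (alpha_sv : slowly_varying alpha) (alpha_ac : locally_abs_continuous alpha)
    (alpha_decr : strictly_decreasing alpha)
    (alpha_at_0 : alpha x @[x --> 0^'+] --> +oo)
    (alpha_at_oo : alpha x @[x --> +oo] --> (0 : R))
    (c_gt0 : 0 < c)
    (A_sv : slowly_varying A) (A_ac : locally_abs_continuous A)
    (A_le1 : forall x : R, 0 < x <= 1 -> A x = a x)
    (A_gt1 : forall x : R, 1 < x -> A x = c * alpha x)
    (B_def : {ae lebesgue_measure, forall x : R, 0 < x -> B x = - x * derive1 A x}) :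
  equal_spaces (J_space C a) (J_space (inter_couple C) A) /\
  equal_spaces (J_space (inter_couple C) A) (K_space (inter_couple C) B).
Proof.
have posD (s : R) : 0 < s -> s \in (pos_half_line : set R).
  by move=> s0; apply/mem_set/mem_half_line.
have a_dec u v : 0 < u -> u < v -> a v < a u.
  by move=> u0 uv; apply: a_decr => //; apply: posD => //; exact: lt_trans uv.
have alpha_dec u v : 0 < u -> u < v -> alpha v < alpha u.
  by move=> u0 uv; apply: alpha_decr => //; apply: posD => //; exact: lt_trans uv.
have A_continuous := locally_abs_continuous_continuous A_ac.
have A_dec1 v : 1 < v -> A v < A 1.
  move=> v1; have [m1 mv] : 1 < (1 + v) / 2 /\ (1 + v) / 2 < v by split; lra.
  have m0 : 0 < (1 + v) / 2 by exact: lt_trans m1.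
  apply: (@lt_le_trans _ _ (A ((1 + v) / 2))).
    by rewrite !A_gt1// ltr_pM2l// alpha_dec.
  have cA : A x @[x --> 1^'+] --> A 1.
    by apply: cvg_at_right_filter; apply: A_continuous; exact: posD.
  rewrite -(cvg_lim _ cA)//; apply: limr_ge; first by apply/cvg_ex; exists (A 1).
  near=> x.
  have x1 : 1 < x by near: x; exact: nbhs_right_gt.
  have xm : x < (1 + v) / 2 by near: x; exact: nbhs_right_lt.
  by rewrite !A_gt1// ler_pM2l// ltW// alpha_dec// (lt_trans ltr01).
have A_dec u v : 0 < u -> u < v -> A v < A u.
  move=> u0 uv; have v0 : 0 < v by exact: lt_trans uv.
  have [v1|v1] := leP v 1.
    by rewrite !A_le1 ?u0 ?v0 ?(le_trans (ltW uv))// a_dec.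
  have [u1|u1] := leP u 1; last by rewrite !A_gt1// ltr_pM2l// alpha_dec.
  apply: (lt_le_trans (A_dec1 _ v1)); move: u1; rewrite le_eqVlt => /predU1P[->//|u1].
  by rewrite !A_le1 ?u0 ?ltr01 ?lexx ?(ltW u1)// ltW// a_dec.
have A_noninc u v : 0 < u -> u <= v -> A v <= A u.
  by move=> u0; rewrite le_eqVlt => /predU1P[->//|/(A_dec _ _ u0)/ltW].
have A_at_0 : A x @[x --> 0^'+] --> +oo.
  apply: cvg_trans a_at_0; apply: near_eq_cvg; near=> x.
  rewrite A_le1//; apply/andP; split; near: x.
    exact: nbhs_right_gt.
  exact: nbhs_right_le.
have A_at_oo : A x @[x --> +oo] --> (0 : R).
  have : c * alpha x @[x --> +oo] --> c * 0 by apply: cvgM => //; exact: cvg_cst.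
  rewrite mulr0; apply: cvg_trans; apply: near_eq_cvg; near=> x.
  by rewrite A_gt1//; near: x; apply: nbhs_pinfty_gt; exact: num_real.
have A_gt0 := weight_gt0 A_dec A_at_oo.
have [l l0 a_cvg] := a_at_oo.
have la s : 0 < s -> l <= a s.
  move=> s0; rewrite -(cvg_lim _ a_cvg)//; apply: limr_le.
    by apply/cvg_ex; exists l.
  near=> x; have sx : s < x by near: x; apply: nbhs_pinfty_gt; exact: num_real.
  by rewrite ltW// a_dec.
have half0 : 0 < 2^-1 :> R by rewrite invr_gt0.
have [M M0 AM] := slowly_varying_almost_increasing A_sv half0.
have [M1 M10 AM1] := slowly_varying_almost_increasing A_sv ltr01.
have {}AM1 u v : 0 < u -> u <= v -> u * A u <= M1 * (v * A v).
  move=> u0 uv; have := AM1 _ _ u0 uv.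
  by rewrite (powRr1 (ltW u0)) (powRr1 (ltW (lt_le_trans u0 uv))).
have [h [mh h0 h_int hA]] :=
  nonincreasing_locally_abs_continuous_density A_noninc A_ac.
have hB : {ae lebesgue_measure, forall z : R, 0 < z -> h z = z^-1 * B z}.
  move: hA B_def; apply: ae_lebesgue_imply2 => z hz Bz z0.
  by rewrite hz// Bz// mulNr mulrN mulrA mulVf ?mul1r// gt_eqF.
have JK := J_inter_embeds_K C A_dec A_continuous A_at_0 A_at_oo M0 AM mh h0 h_int hB
  A_gt0 M10 AM1.
have JaK := J_embeds_K C A_dec A_continuous A_at_0 A_at_oo M0 AM mh h0 h_int hB
  A_gt0 l0 la A_le1.
have KJ := K_embeds_J_inter C A_dec A_continuous A_at_0 A_at_oo mh h0 h_int hB A_gt0.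
have KJa := K_embeds_J C A_dec A_continuous A_at_0 A_at_oo mh h0 h_int hB A_gt0 A_le1.
split; last exact: embeds_equal_spaces.
by apply: embeds_equal_spaces; [exact: embeds_trans KJ|exact: embeds_trans KJa].
Unshelve. all: by end_near. Qed.
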